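(* Let $q$ be an odd prime power and let $\mathcal C$ be an irreducible conic of $\mathrm{PG}(2,q^2)$ which is not defined over $\mathbb F_q$ and has at least one point in $\mathrm{PG}(2,q)$. Then: (i) if $q=3$, $E_q(\mathcal C)\in\{3,4,5,6,7,8,9\}$; (ii) if $q=5$, $E_q(\mathcal C)\in\{11,12,14,15,16,17,19,20,21,22,25\}$; (iii) if $q>5$, then $E_q(\mathcal C)=\frac12\big(q^2+(\alpha-1)q-n_0\big)$ for some $n_0\in\{0,1,2,3\}$ and $\alpha\in\{1,2,3,4,5,7\}$ with $\alpha-n_0$ even.
   Context: $\mathrm{PG}(2,q)$ is regarded as canonically embedded in $\mathrm{PG}(2,q^2)$. A conic is the zero set of a quadratic form $F\in\mathbb F_{q^2}[X_0,X_1,X_2]$; it is irreducible if $F$ is absolutely irreducible, and defined over $\mathbb F_q$ if $F$ is a scalar multiple of a form with coefficients in $\mathbb F_q$. A point not on $\mathcal C$ is external to $\mathcal C$ if it lies on two tangent lines to $\mathcal C$, internal if on none. $E_q(\mathcal C)$ is the number of points of $\mathrm{PG}(2,q)$ external to $\mathcal C$. *)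

(* Defs.v *)
From HB Require Import structures.
From mathcomp Require Import all_boot all_order all_algebra all_field.
From mathcomp Require Import mpoly.
Set Implicit Arguments. Unset Strict Implicit. Unset Printing Implicit Defensive.
Import GRing.Theory.
Local Open Scope ring_scope.

Section Conics.
Variables (L : finFieldType) (q : nat).

(* A vector of L^3 is the *normalized* representative of a projective point
   of PG(2,|L|): its first nonzero coordinate equals 1.  Each point of
   PG(2,q^2) has exactly one normalized representative. *)
Definition normalized (v : 'I_3 -> L) : bool :=
  [exists i : 'I_3, (v i == 1) && [forall j : 'I_3, (j < i)%N ==> (v j == 0)]].

Definition pg2 : {set {ffun 'I_3 -> L}} := [set v : {ffun 'I_3 -> L} | normalized v].

Definition inFq (x : L) : bool := x ^+ q == x.

Definition pg2q : {set {ffun 'I_3 -> L}} :=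
  [set v : {ffun 'I_3 -> L} | normalized v & [forall i, inFq (v i)]].

Definition quadratic_form (F : {mpoly L[3]}) : Prop := F != 0 /\ F \is 2.-homog.

Definition on_conic (F : {mpoly L[3]}) (v : {ffun 'I_3 -> L}) : bool :=
  F.@[v] == 0.

(* F absolutely irreducible: irreducible over every field extension of L
   (equivalently over the algebraic closure): every factorization has a
   constant factor. *)
Definition abs_irreducible (F : {mpoly L[3]}) : Prop :=
  forall (K : fieldType) (f : {rmorphism L -> K}) (g h : {mpoly K[3]}),
    map_mpoly f F = g * h -> (msize g <= 1)%N \/ (msize h <= 1)%N.

Definition defined_over_Fq (F : {mpoly L[3]}) : Prop :=
  exists (c : L) (G : {mpoly L[3]}),
    (forall m, inFq G@_m) /\ F = c *: G.

Definition grad (F : {mpoly L[3]}) (v : {ffun 'I_3 -> L}) : {ffun 'I_3 -> L} :=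
  [ffun i => (F^`M(i)).@[v]].

(* Lines of PG(2,q^2) are given by normalized coordinate vectors l,
   the line being {x | sum_i l_i x_i = 0}.  The line l is tangent to the
   conic F if it is the tangent line at some (nonsingular) point P of the
   conic, i.e. l is proportional to the (nonzero) gradient of F at P. *)
Definition tangent_line (F : {mpoly L[3]}) (l : {ffun 'I_3 -> L}) : bool :=
  normalized l &&
  [exists P in pg2, on_conic F P && (grad F P != 0) &&
     [exists c : L, (c != 0) && (l == [ffun i => c * grad F P i])]].

Definition incident (l x : {ffun 'I_3 -> L}) : bool :=
  \sum_(i < 3) l i * x i == 0.

Definition n_tangents (F : {mpoly L[3]}) (x : {ffun 'I_3 -> L}) : nat :=
  #|[set l : {ffun 'I_3 -> L} | tangent_line F l & incident l x]|.

Definition external (F : {mpoly L[3]}) (x : {ffun 'I_3 -> L}) : bool :=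
  ~~ on_conic F x && (n_tangents F x == 2)%N.

Definition Eq (F : {mpoly L[3]}) : nat := #|[set x in pg2q | external F x]|.

End Conics.

(* Main.v *)
(** Let B be the Gram matrix of F, f(v) = v B v^T, and let eta be the quadratic
    character of L = F_{q^2}.  A point x off the conic is external iff
    -det B * f(x) is a nonzero square, so E_q is determined by the character sum
    of eta (det B * f) over F_q^3 and by the number of zeros of f there.
    Choose coordinates over F_q with a rational point of the conic at (1,0,0):
    f = x l(y,z) + m(y,z) with l linear and m quadratic over L.  Since nonzero
    elements of F_q are squares in L, and sum_{x in F_q} eta(x + u) = -1 for u
    outside F_q, the sum along a direction (y,z) is explicit: only the rational
    directions with l = 0 or m/l in F_q contribute with weight q.
    If there are two independent directions of the second kind, the conic passes
    through a rational frame, f = a xy + b xz + yz up to a scalar, and the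
    contributions are eta(a), eta(b) and, when it exists, that of a third
    direction, multiplied by eta(det B) = eta(ab); otherwise at most one such
    direction occurs.  In each case
    2 E_q = q^2 + q + t q - n0, where n0 + 1 is the number of rational points and
    (n0, t) is (0,0), (0,2), (1,-1), (1,1), (2,0), (2,2), (3,-1) or (3,3). *)
Require Import Defs.
From HB Require Import structures.
From mathcomp Require Import all_boot all_order all_algebra all_field.
From mathcomp Require Import mpoly.
From mathcomp Require Import ring lra zify.
Set Implicit Arguments. Unset Strict Implicit. Unset Printing Implicit Defensive.
Import Order.TTheory GRing.Theory Num.Theory.
Local Open Scope ring_scope.

(** * The quadratic character of a finite field of odd order *)

Section QuadraticCharacter.
Variable L : finFieldType.
Hypothesis oddL : odd #|L|.

Definition is_square (u : L) : bool := [exists y, u == y ^+ 2].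

Definition eta (u : L) : int :=
  if u == 0 then 0 else if is_square u then 1 else -1.

Lemma finField_prim_root : exists w : L, #|L|.-1.-primitive_root w.
Proof.
have n0 : (0 < #|L|.-1)%N by rewrite -subn1 subn_gt0 finNzRing_gt1.
pose rs := enum (predC1 (0 : L)).
have rs1 : all #|L|.-1.-unity_root rs.
  apply/allP => u; rewrite mem_enum /= => u0.
  apply/unity_rootP; apply: (mulfI u0).
  by rewrite -exprS prednK ?mulr1 ?expf_card // ltnW // finNzRing_gt1.
have sz : (#|L|.-1 <= size rs)%N by rewrite -cardE cardC1.
by case/hasP: (cyclic.has_prim_root n0 rs1 (enum_uniq _) sz) => w _ pw; exists w.
Qed.

Lemma finField_prim_rootP (w u : L) : #|L|.-1.-primitive_root w -> u != 0 ->
  exists i, u = w ^+ i.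
Proof.
move=> pw u0; have e1 : u ^+ #|L|.-1 = 1.
  apply: (mulfI u0).
  by rewrite -exprS prednK ?mulr1 ?expf_card // ltnW // finNzRing_gt1.
by case: (prim_rootP pw e1) => i ->; exists i.
Qed.

Lemma even_card_unit : (2 %| #|L|.-1)%N.
Proof.
have := finNzRing_gt1 L; move: oddL; case: #|L| => // n; rewrite dvdn2 /=.
by move=> ->.
Qed.

Lemma prim_root_neq0 (w : L) : #|L|.-1.-primitive_root w -> w != 0.
Proof.
by move=> pw; rewrite (prim_root_eq0 pw) -lt0n -subn1 subn_gt0 finNzRing_gt1.
Qed.

(** With [h] half the order of [w], in characteristic 2 the square of [w ^+ h - 1] would be
    [w ^+ (h * 2) - 1 = 0], forcing [w ^+ h = 1]. *)
Lemma two_neq0 : 2%:R != 0 :> L.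
Proof.
have [w pw] := finField_prim_root; have n1 := finNzRing_gt1 L.
have [h hE] : exists h, #|L|.-1 = (h * 2)%N by apply/dvdnP/even_card_unit.
apply/eqP => two0; have : (w ^+ h - 1) ^+ 2 == 0.
  have -> : (w ^+ h - 1) ^+ 2 = (w ^+ h) ^+ 2 - 1 + 2%:R * (1 - w ^+ h) by ring.
  by rewrite -exprM -hE (prim_expr_order pw) subrr two0 mul0r addr0.
rewrite expf_eq0 subr_eq0 /= -(prim_order_dvd pw) => /dvdn_leq.
by move: #|_| n1 hE => N; lia.
Qed.

Lemma is_square_prim_root (w : L) i : #|L|.-1.-primitive_root w ->
  is_square (w ^+ i) = ~~ odd i.
Proof.
move=> pw; apply/existsP/idP => [[y]|ei].
  have y0 : y != 0 \/ y = 0 by case: eqVneq; [right|left].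
  case: y0 => [y0|->]; last first.
    by rewrite expr0n expf_eq0 (negPf (prim_root_neq0 pw)) andbF.
  have [j ->] := finField_prim_rootP pw y0; rewrite -exprM.
  rewrite (eq_prim_root_expr pw) => /eqP/(congr1 (fun x => x %% 2)%N).
  rewrite !(modn_dvdm _ even_card_unit) mulnC modnMr modn2.
  by case: odd.
exists (w ^+ i./2); rewrite -exprM.
by rewrite {1}(eqP (etrans (eq_sym _ _) (introT eqP (odd_double_half i)))) (negPf ei) -muln2.
Qed.

Lemma eta_prim_root (w : L) i : #|L|.-1.-primitive_root w ->
  eta (w ^+ i) = (-1) ^+ i.
Proof.
move=> pw; rewrite /eta expf_eq0 (negPf (prim_root_neq0 pw)) andbF.
rewrite is_square_prim_root // -signr_odd.
by case: odd.
Qed.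

Lemma eta0 : eta 0 = 0. Proof. by rewrite /eta eqxx. Qed.

Lemma etaM u v : eta (u * v) = eta u * eta v.
Proof.
have [->|u0] := eqVneq u 0; first by rewrite mul0r eta0 mul0r.
have [->|v0] := eqVneq v 0; first by rewrite mulr0 eta0 mulr0.
have [w pw] := finField_prim_root.
have [i ->] := finField_prim_rootP pw u0.
have [j ->] := finField_prim_rootP pw v0.
by rewrite -exprD !eta_prim_root // exprD.
Qed.

Lemma eta_sq u : u != 0 -> eta (u ^+ 2) = 1.
Proof.
move=> u0; rewrite /eta expf_eq0 (negPf u0) /=.
by rewrite ifT //; apply/existsP; exists u.
Qed.

Lemma eta_pm1 u : u != 0 -> eta u = 1 \/ eta u = -1.
Proof. by rewrite /eta => /negPf->; case: is_square; [left|right]. Qed.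

Lemma eta_eq1 u : (eta u == 1) = (u != 0) && is_square u.
Proof. by rewrite /eta; case: (u == 0) => //; case: is_square. Qed.

(** A primitive root [w] is a nonsquare, so substituting [w * u] for [u] changes the sign of the
    sum. *)
Lemma sum_eta : \sum_u eta u = 0.
Proof.
have [w pw] := finField_prim_root.
have w0 := prim_root_neq0 pw.
have ew : eta w = -1 by rewrite -[w]expr1 eta_prim_root.
have : \sum_u eta u = - \sum_u eta u.
  rewrite {1}(reindex_inj (mulfI w0)) -sumrN.
  by apply: eq_bigr => u _; rewrite etaM ew mulN1r.
lia.
Qed.

End QuadraticCharacter.

(** Having the power map as a ring morphism makes the closure properties of its fixed field
    immediate. *)
Lemma finField_Frobenius_iter (L : finFieldType) (p k n : nat) :
  prime p -> #|L| = (p ^ n)%N ->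
  exists s : {rmorphism L -> L}, forall x, s x = x ^+ (p ^ k).
Proof.
move=> pp cL; have ch := card_finPcharP cL pp.
elim: k => [|k [s sE]]; first by exists idfun => x; rewrite expr1.
exists (pFrobenius_aut ch \o s) => x.
by rewrite /= pFrobenius_autE sE -exprM -expnSr.
Qed.

(** * The subfield of order q and character sums along its cosets *)

Section Subfield.
Variables (L : finFieldType) (q : nat) (sig : {rmorphism L -> L}).
Hypothesis oddq : odd q.
Hypothesis cardL : #|L| = (q ^ 2)%N.
Hypothesis sigE : forall x, sig x = x ^+ q.

Local Notation eta := (@eta L).

Lemma odd_cardL : odd #|L|. Proof. by rewrite cardL oddX oddq. Qed.

Lemma q_gt1 : (1 < q)%N.
Proof. by have := finNzRing_gt1 L; rewrite cardL; case: (q) oddq => [|[]]. Qed.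

Definition Fq : {set L} := [set x | sig x == x].

Lemma FqE x : (x \in Fq) = (sig x == x). Proof. by rewrite inE. Qed.
Lemma FqP x : reflect (sig x = x) (x \in Fq). Proof. by rewrite FqE; apply: eqP. Qed.
Lemma Fq0 : 0 \in Fq. Proof. by rewrite FqE rmorph0. Qed.
Lemma Fq1 : 1 \in Fq. Proof. by rewrite FqE rmorph1. Qed.
Lemma FqD x y : x \in Fq -> y \in Fq -> x + y \in Fq.
Proof. by move=> /FqP ex /FqP ey; apply/FqP; rewrite rmorphD ex ey. Qed.
Lemma FqM x y : x \in Fq -> y \in Fq -> x * y \in Fq.
Proof. by move=> /FqP ex /FqP ey; apply/FqP; rewrite rmorphM /= ex ey. Qed.
Lemma FqN x : x \in Fq -> - x \in Fq.
Proof. by move=> /FqP ex; apply/FqP; rewrite rmorphN ex. Qed.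
Lemma FqB x y : x \in Fq -> y \in Fq -> x - y \in Fq.
Proof. by move=> fx fy; rewrite FqD ?FqN. Qed.
Lemma FqV x : x \in Fq -> x^-1 \in Fq.
Proof. by move=> /FqP ex; apply/FqP; rewrite fmorphV ex. Qed.
Lemma Fq_div x y : x \in Fq -> y \in Fq -> x / y \in Fq.
Proof. by move=> fx fy; rewrite FqM ?FqV. Qed.
Lemma Fq_nat n : n%:R \in Fq.
Proof. by apply/FqP; rewrite rmorph_nat. Qed.

Lemma FqMl x y : x \in Fq -> x != 0 -> (x * y \in Fq) = (y \in Fq).
Proof.
move=> fx x0; apply/idP/idP => [fxy|]; last exact: FqM.
by rewrite -[y](mulKf x0) FqM ?FqV.
Qed.

(** Being fixed by the [q]-th power means that [q ^ 2 - 1] divides [i * (q - 1)]; cancel [q - 1]. *)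
Lemma Fq_prim_root w i : #|L|.-1.-primitive_root w ->
  (w ^+ i \in Fq) = (q.+1 %| i)%N.
Proof.
move=> pw; have q1 := q_gt1; rewrite FqE sigE -exprM (eq_prim_root_expr pw) cardL.
have -> : ((q ^ 2).-1 = (q.-1 * q.+1))%N by nia.
have -> : (i * q = i + q.-1 * i)%N by nia.
rewrite -{3}[i]addn0 eqn_modDl mod0n -/(dvdn _ _) dvdn_pmul2l //; lia.
Qed.

Lemma card_Fq : #|Fq| = q.
Proof.
have [w pw] := finField_prim_root L; have q1 := q_gt1.
have w0 := prim_root_neq0 pw.
pose h (j : 'I_q.-1) := w ^+ (q.+1 * j).
have h_inj : injective h.
  move=> i j /eqP; rewrite /h (eq_prim_root_expr pw) cardL.
  have -> : ((q ^ 2).-1 = (q.+1 * q.-1))%N by nia.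
  by rewrite -!muln_modr eqn_pmul2l // !modn_small // => /eqP/val_inj.
have -> : Fq = 0 |: [set h j | j in 'I_q.-1].
  apply/setP => x; rewrite in_setU1; have [->|x0] /= := eqVneq x 0.
    exact: Fq0.
  apply/idP/imsetP => [|[j _ ->]]; last by rewrite Fq_prim_root ?dvdn_mulr.
  have [i ->] := finField_prim_rootP pw x0.
  rewrite Fq_prim_root // => /dvdnP[j ->].
  have j0 : (j %% q.-1 < q.-1)%N by rewrite ltn_mod; lia.
  exists (Ordinal j0) => //; apply/eqP; rewrite (eq_prim_root_expr pw) cardL /=.
  have -> : ((q ^ 2).-1 = (q.+1 * q.-1))%N by nia.
  by rewrite [(j * _)%N]mulnC -!muln_modr modn_mod.
rewrite cardsU1 card_imset // card_ord.
have -> : 0 \notin [set h j | j in 'I_q.-1].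
  apply/imsetP => -[j _ /esym/eqP]; rewrite /h expf_eq0 (negPf w0) andbF //.
by rewrite add1n prednK //; lia.
Qed.

(** Since [q.+1] is even, a nonzero element of F_q is an even power of a primitive root of L. *)
Lemma eta_Fq x : x \in Fq -> x != 0 -> eta x = 1.
Proof.
have [w pw] := finField_prim_root L.
move=> fx /(finField_prim_rootP pw)[i xE]; move: fx; rewrite xE.
rewrite Fq_prim_root // eta_prim_root ?odd_cardL // -signr_odd => /dvdnP[j ->].
by rewrite oddM /= oddq andbF.
Qed.

Lemma eta_FqM x y : x \in Fq -> x != 0 -> eta (x * y) = eta y.
Proof. by move=> fx x0; rewrite etaM ?odd_cardL // eta_Fq // mul1r. Qed.

Lemma etaN x : eta (- x) = eta x.
Proof. by rewrite -mulN1r eta_FqM ?FqN ?Fq1 // oppr_eq0 oner_eq0. Qed.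

Definition Fq2 : {set L * L} := setX Fq Fq.

Lemma card_Fq2 : #|Fq2| = (q ^ 2)%N.
Proof. by rewrite cardsX card_Fq. Qed.

Lemma Fq2E p : (p \in Fq2) = (p.1 \in Fq) && (p.2 \in Fq).
Proof. by case: p => y z; rewrite in_setX. Qed.

Lemma sum_Fq2 (G : L -> L -> int) :
  \sum_(p in Fq2) G p.1 p.2 = \sum_(y in Fq) \sum_(z in Fq) G y z.
Proof.
by rewrite pair_big /=; apply: eq_bigl => p; rewrite Fq2E.
Qed.

(** The hypothesis is independence of [a] and [b] over F_q. The additive map from F_q^2 to L is then
    injective, hence bijective by cardinality, and the sum runs over all of L. *)
Lemma sum_Fq2_inj (a b : L) :
  (forall p, p \in Fq2 -> a * p.1 + b * p.2 = 0 -> p = 0) ->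
  (forall u, exists2 p, p \in Fq2 & u = a * p.1 + b * p.2) /\
  \sum_(p in Fq2) eta (a * p.1 + b * p.2) = 0.
Proof.
move=> inj0; pose h (p : L * L) := a * p.1 + b * p.2.
have h_inj : {in Fq2 &, injective h}.
  move=> p r; rewrite !Fq2E => /andP[p1 p2] /andP[r1 r2] /eqP.
  rewrite -subr_eq0 => /eqP e; apply/eqP; rewrite -subr_eq0; apply/eqP.
  by apply: inj0; rewrite ?Fq2E /= ?FqB // -e /h; ring.
have imT : h @: Fq2 = setT.
  by apply/eqP; rewrite eqEcard subsetT cardsT card_in_imset // card_Fq2 cardL leqnn.
split=> [u|].
  have /imsetP[p fp ->] : u \in h @: Fq2 by rewrite imT inE.
  by exists p.
rewrite -(big_imset eta h_inj) imT -[RHS](sum_eta odd_cardL).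
by apply: eq_bigl => u; rewrite in_setT.
Qed.

Lemma sum_Fq_unit_const (c : int) :
  \sum_(x in Fq | x != 0) c = (q%:Z - 1) * c.
Proof.
have : \sum_(x in Fq) c = c *+ q by rewrite sumr_const card_Fq.
rewrite (bigD1 0) ?Fq0 //= => e.
by rewrite mulrBl mul1r -natz mulr_natl -e addrAC subrr add0r.
Qed.

(** Writing the elements of L as y + m z, the total sum of [eta] is 0. The terms with z = 0 give q -
    1, and each of the q - 1 values z != 0 gives the wanted sum once the factor z, a square in L, is
    taken out. *)
Lemma sum_eta_line m : m \notin Fq -> \sum_(x in Fq) eta (x + m) = -1.
Proof.
move=> fm.
have /sum_Fq2_inj[_] : forall p, p \in Fq2 -> 1 * p.1 + m * p.2 = 0 -> p = 0.
  case=> y z; rewrite in_setX /= mul1r => /andP[fy fz] e.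
  have [z0|z0] := eqVneq z 0; first by move: e; rewrite z0 mulr0 addr0 => ->.
  case/negP: fm; have -> : m = - y / z.
    apply: (mulIf z0); rewrite divfK //; apply/eqP.
    by rewrite -subr_eq0 opprK addrC e.
  by rewrite Fq_div ?FqN.
rewrite (sum_Fq2 (fun y z => eta (1 * y + m * z))) exchange_big /=.
rewrite (bigD1 0) ?Fq0 //=.
have -> : \sum_(j in Fq) eta (1 * j + m * 0) = q%:Z - 1.
  rewrite (bigD1 0) ?Fq0 //= !mulr0 addr0 eta0 add0r.
  rewrite (eq_bigr (fun=> 1%:Z)); last first.
    by move=> y /andP[fy y0]; rewrite mul1r addr0 eta_Fq.
  by rewrite sum_Fq_unit_const mulr1.
rewrite (eq_bigr (fun=> \sum_(x in Fq) eta (x + m))); last first.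
  move=> z /andP[fz z0]; rewrite (reindex_inj (mulfI z0)) /=.
  apply: eq_big => [x|x fx]; first by rewrite FqMl.
  rewrite -(eta_FqM (x + m) fz z0); congr eta; ring.
rewrite sum_Fq_unit_const; have := q_gt1.
by move: (\sum_(_ in _) _) => S; nia.
Qed.

End Subfield.

(** * Proportionality of vectors in the plane *)

Section ProportionalPairs.
Variable R : fieldType.
Implicit Types r p : R * R.

Lemma scale_pair_inj r : r != 0 -> injective (fun s => (s * r.1, s * r.2)).
Proof.
move=> r0 s t []; have [e|e] := eqVneq r.1 0; last by move/(mulIf e).
have e2 : r.2 != 0 by apply: contraNneq r0; case: r e => ? ? /= -> ->.
by move=> _ /(mulIf e2).
Qed.

Lemma scale_pair_neq0 s r : s != 0 -> r != 0 -> (s * r.1, s * r.2) != 0.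
Proof.
move=> s0 r0; rewrite xpair_eqE !mulf_eq0 (negPf s0) /=.
by case: r r0 => y z; rewrite xpair_eqE.
Qed.

Lemma proportional_pair r p : r != 0 -> p != 0 -> r.1 * p.2 = r.2 * p.1 ->
  exists2 s, s != 0 & p = (s * r.1, s * r.2).
Proof.
case: r p => [y1 z1] [y z] /= r0 p0 e.
have [y10|y10] := eqVneq y1 0.
  have z10 : z1 != 0 by apply: contraNneq r0 => z10; rewrite y10 z10.
  have y0 : y = 0.
    by move/esym/eqP: e; rewrite y10 mul0r mulf_eq0 (negPf z10) => /eqP.
  have z0 : z != 0 by apply: contraNneq p0 => z0; rewrite y0 z0.
  exists (z / z1); first by rewrite mulf_neq0 ?invr_eq0.
  by rewrite divfK // y10 y0 mulr0.
have y0 : y != 0.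
  apply: contraNneq p0 => y0; move/eqP: e.
  by rewrite y0 mulr0 mulf_eq0 (negPf y10) => /eqP->.
exists (y / y1); first by rewrite mulf_neq0 ?invr_eq0.
rewrite divfK //; congr (_, _); apply: (mulfI y10); rewrite e.
by rewrite mulrA [y1 * _]mulrC divfK // mulrC.
Qed.

End ProportionalPairs.

(** * Sums along the directions of a pencil of lines *)

Section Directions.
Variables (L : finFieldType) (q : nat) (sig : {rmorphism L -> L}).
Hypothesis oddq : odd q.
Hypothesis cardL : #|L| = (q ^ 2)%N.
Hypothesis sigE : forall x, sig x = x ^+ q.
Local Notation eta := (@eta L).
Local Notation Fq := (Fq sig).
Local Notation Fq2 := (Fq2 sig).

(** The polynomial [x * l + m] in [x] has exactly one zero, [- (m / l)], and this zero is
    rational. *)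
Definition rat_ratio (l m : L) : bool := (l != 0) && (m / l \in Fq).

(** If [l] is 0 the summand is constant. Otherwise [eta l] comes out, and the sum of
    [eta (x + m / l)] is q - 1 or -1 according as [m / l] is rational or not. *)
Lemma sum_eta_affine (l m : L) :
  \sum_(x in Fq) eta (x * l + m) =
  - eta l + q%:Z * ((rat_ratio l m)%:R * eta l) + q%:Z * ((l == 0)%:R * eta m).
Proof.
rewrite /rat_ratio; have [->|l0] /= := eqVneq l 0.
  rewrite (eq_bigr (fun=> eta m)) => [|x _]; last by rewrite mulr0 add0r.
  by rewrite sumr_const (card_Fq oddq cardL sigE) eta0 -[eta m *+ q]mulr_natl -[q%:Z]natz; ring.
have -> : \sum_(x in Fq) eta (x * l + m) = eta l * \sum_(x in Fq) eta (x + m / l).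
  rewrite mulr_sumr; apply: eq_bigr => x _.
  by rewrite -(etaM (odd_cardL oddq cardL)) mulrDr [l * (m / l)]mulrC divfK // mulrC.
have [fm|fm] := boolP (m / l \in Fq); last first.
  by rewrite (sum_eta_line oddq cardL sigE fm) /=; ring.
rewrite (reindex_inj (subIr (m / l))) /=.
rewrite (eq_bigl (fun x => x \in Fq)) => [|x]; last first.
  apply/idP/idP => fx; last exact: FqB fx fm.
  by have := FqD fx fm; rewrite subrK.
rewrite (eq_bigr (fun x => eta x)) => [|x _]; last by rewrite subrK.
rewrite (bigD1 0) ?Fq0 //= eta0 (eq_bigr (fun=> 1%:Z)); last first.
  by move=> y /andP[fy y0]; rewrite (eta_Fq oddq cardL sigE).
rewrite (sum_Fq_unit_const oddq cardL sigE); ring.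
Qed.

Lemma sum_zero_affine (l m : L) :
  \sum_(x in Fq) (x * l + m == 0)%:R =
  (rat_ratio l m)%:R + q%:Z * ((l == 0)%:R * (m == 0)%:R).
Proof.
rewrite /rat_ratio; have [->|l0] /= := eqVneq l 0.
  rewrite (eq_bigr (fun=> (m == 0)%:R)) => [|x _]; last by rewrite mulr0 add0r.
  by rewrite sumr_const (card_Fq oddq cardL sigE) -[_ *+ q]mulr_natl -[q%:Z]natz; ring.
have eqx x : (x * l + m == 0) = (x == - (m / l)).
  apply/eqP/eqP => [e|->]; last by rewrite mulNr divfK // addNr.
  by apply: (mulIf l0); rewrite mulNr divfK //; apply/eqP; rewrite -subr_eq0 opprK e.
rewrite mul0r mulr0 addr0; have [fm|fm] := boolP (m / l \in Fq).
  rewrite (bigD1 (- (m / l))) ?FqN //= eqx eqxx big1 ?addr0 // => x /andP[_ x0].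
  by rewrite eqx (negPf x0).
rewrite big1 // => x fx; rewrite eqx; case: eqP => // xE.
by case/negP: fm; rewrite -[m / l]opprK -xE FqN.
Qed.

(** The vector 0 is left out, so this is the set of all rational vectors representing one projective
    direction. *)
Definition line (r : L * L) : {set L * L} :=
  [set (s * r.1, s * r.2) | s in Fq :\ 0].

Lemma lineE (r p : L * L) : r \in Fq2 -> p \in Fq2 -> r != 0 -> p != 0 ->
  (p \in line r) = (r.1 * p.2 == r.2 * p.1).
Proof.
rewrite !Fq2E => /andP[r1 r2] /andP[p1 p2] r0 p0; apply/imsetP/eqP.
  by case=> s _ -> /=; ring.
(* The factor [s] is rational, as a quotient of rational coordinates taken where [r] does not
   vanish. *)
case/(proportional_pair r0 p0) => s s0 pE; exists s; rewrite // in_setD1 s0 /=.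
move: p1 p2; rewrite pE /=; have [e|e] := eqVneq r.1 0; last first.
  by rewrite mulrC FqMl.
have e2 : r.2 != 0 by apply: contraNneq r0; case: (r) e => ? ? /= -> ->.
by move=> _; rewrite mulrC FqMl.
Qed.

Lemma line_neq0 (r p : L * L) : r != 0 -> p \in line r -> p != 0.
Proof.
by move=> r0 /imsetP[s]; rewrite in_setD1 => /andP[s0 _] ->; apply: scale_pair_neq0.
Qed.

Lemma line0 (r : L * L) : r != 0 -> (0 \in line r) = false.
Proof. by move=> r0; apply/negP => /(line_neq0 r0); rewrite eqxx. Qed.

Lemma line_sub (r : L * L) : r \in Fq2 -> line r \subset Fq2.
Proof.
rewrite Fq2E => /andP[r1 r2]; apply/subsetP => p /imsetP[s].
by rewrite in_setD1 => /andP[_ fs] ->; rewrite Fq2E /= !FqM.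
Qed.

(** The line enters as an indicator inside a sum over all of [Fq2], so that the contributions of
    several directions can be added term by term. *)
Lemma sum_line (r : L * L) (G : L * L -> int) :
  r \in Fq2 -> r != 0 ->
  (forall s, s \in Fq -> s != 0 -> G (s * r.1, s * r.2) = G r) ->
  \sum_(p in Fq2) (p \in line r)%:R * G p = (q%:Z - 1) * G r.
Proof.
move=> fr r0 Gr.
rewrite (bigID (mem (line r))) /= [X in _ + X]big1 ?addr0; last first.
  by move=> p /andP[_ /negPf->]; rewrite mul0r.
rewrite (eq_bigl (mem (line r))) => [|p]; last first.
  by apply: andb_idl => /(subsetP (line_sub fr)).
rewrite big_imset /=; last by move=> s t _ _; apply: scale_pair_inj.
rewrite (eq_bigr (fun=> G r)) => [|s]; last first.
  rewrite !inE => /andP[s0 fs]; rewrite Gr // ?FqE // imset_f ?mul1r //.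
  by rewrite !inE s0.
rewrite -(sum_Fq_unit_const oddq cardL sigE); apply: eq_bigl => x.
by rewrite !inE andbC.
Qed.

Lemma sum_pt0 (G : L * L -> int) : \sum_(p in Fq2) (p == 0)%:R * G p = G 0.
Proof.
rewrite (bigD1 (0 : L * L)) ?Fq2E ?Fq0 //= eqxx mul1r big1 ?addr0 // => p /andP[_ p0].
by rewrite (negPf p0) mul0r.
Qed.

(* The pairs (n0, alpha) of the theorem that actually occur. *)
Definition admissible : seq (nat * nat) :=
  [:: (0, 2); (0, 4); (1, 1); (1, 3); (2, 2); (2, 4); (3, 1); (3, 5)]%N.

(** [S] stands for the character sum and [Z] for the number of zeros of the form in F_q^3. The zero
    vector accounts for the final 1 and each of the n0 + 1 rational points for q - 1 vectors. *)
Definition good_counts (S Z : int) : Prop :=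
  exists n0 a, [/\ (n0, a) \in admissible,
    S = q%:Z * (q%:Z - 1) * (a%:Z - 2%:Z) & Z = n0.+1%:Z * (q%:Z - 1) + 1].

Lemma sum_eta_dir (l m : L * L -> L) :
  \sum_(p in Fq2) \sum_(x in Fq) eta (x * l p + m p) =
  - (\sum_(p in Fq2) eta (l p))
  + q%:Z * (\sum_(p in Fq2) (rat_ratio (l p) (m p))%:R * eta (l p))
  + q%:Z * (\sum_(p in Fq2) (l p == 0)%:R * eta (m p)).
Proof.
rewrite -sumrN !mulr_sumr -!big_split /=.
by apply: eq_bigr => p _; rewrite sum_eta_affine.
Qed.

Lemma sum_zero_dir (l m : L * L -> L) :
  \sum_(p in Fq2) \sum_(x in Fq) (x * l p + m p == 0)%:R =
  \sum_(p in Fq2) (rat_ratio (l p) (m p))%:R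
  + q%:Z * (\sum_(p in Fq2) (l p == 0)%:R * (m p == 0)%:R).
Proof.
rewrite !mulr_sumr -!big_split /=.
by apply: eq_bigr => p _; rewrite sum_zero_affine.
Qed.

Lemma sum_pt0_1 : \sum_(p in Fq2) ((p == 0 :> L * L)%:R : int) = 1.
Proof.
by rewrite -[RHS](sum_pt0 (fun=> 1)); apply: eq_bigr => p _; rewrite mulr1.
Qed.

Lemma sum_line_1 (r : L * L) : r \in Fq2 -> r != 0 ->
  \sum_(p in Fq2) ((p \in line r)%:R : int) = q%:Z - 1.
Proof.
move=> fr r0; have := @sum_line r (fun=> 1) fr r0 (fun _ _ _ => erefl).
by rewrite mulr1 => <-; apply: eq_bigr => p _; rewrite mulr1.
Qed.

End Directions.

(** * The possible configurations of rational directions *)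

Section Cases.
Variables (L : finFieldType) (q : nat) (sig : {rmorphism L -> L}).
Hypothesis oddq : odd q.
Hypothesis cardL : #|L| = (q ^ 2)%N.
Hypothesis sigE : forall x, sig x = x ^+ q.
Local Notation eta := (@eta L).
Local Notation Fq := (Fq sig).
Local Notation Fq2 := (Fq2 sig).
Local Notation rat_ratio := (rat_ratio sig).
Local Notation line := (line sig).

Let oddL := odd_cardL oddq cardL.
Let etaM := etaM oddL.
Let eta_FqM := eta_FqM oddq cardL sigE.
Let eta_Fq := eta_Fq oddq cardL sigE.
Let sum_line := sum_line oddq cardL sigE.
Let sum_line_1 := sum_line_1 oddq cardL sigE.
Let lineE := @lineE L sig.
Let sum_eta_dir := sum_eta_dir oddq cardL sigE.
Let sum_zero_dir := sum_zero_dir oddq cardL sigE.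

Definition lin (a b : L) (p : L * L) : L := a * p.1 + b * p.2.
Definition quad (m0 m1 m2 : L) (p : L * L) : L :=
  m0 * p.1 ^+ 2 + m1 * (p.1 * p.2) + m2 * p.2 ^+ 2.

Lemma eta_lin_scale a b s (r : L * L) : s \in Fq -> s != 0 ->
  eta (lin a b (s * r.1, s * r.2)) = eta (lin a b r).
Proof. by move=> fs s0; rewrite -[RHS](eta_FqM _ fs s0) /lin /=; congr eta; ring. Qed.

Lemma eta_quad_scale m0 m1 m2 s (r : L * L) : s \in Fq -> s != 0 ->
  eta (quad m0 m1 m2 (s * r.1, s * r.2)) = eta (quad m0 m1 m2 r).
Proof.
move=> fs s0; rewrite -[RHS](eta_FqM _ (FqM fs fs)) ?mulf_neq0 //.
by rewrite /quad /=; congr eta; ring.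
Qed.

Lemma lin0 a b : lin a b 0 = 0. Proof. by rewrite /lin !mulr0 addr0. Qed.
Lemma quad0 m0 m1 m2 : quad m0 m1 m2 0 = 0.
Proof. by rewrite /quad /= mulr0 expr0n /= !mulr0 !addr0. Qed.

(** The determinant of [r] and [p], multiplied by [a] or by [b], is a combination of the values of
    the form at [r] and [p]; one of the two coefficients is nonzero. *)
Lemma lin_zeros a b (r p : L * L) :
  (a != 0) || (b != 0) -> r \in Fq2 -> r != 0 -> lin a b r = 0 -> p \in Fq2 ->
  (lin a b p == 0) = (p == 0) || (p \in line r).
Proof.
move=> ab0 fr r0 lr fp; have [->|p0] /= := eqVneq p 0; first by rewrite lin0 eqxx.
rewrite lineE //; move: lr; rewrite /lin => lr.
apply/eqP/eqP => [lp|e].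
  apply/eqP; rewrite -subr_eq0; case/orP: ab0 => x0; apply/eqP; apply: (mulfI x0).
    have -> : a * (r.1 * p.2 - r.2 * p.1) =
      p.2 * (a * r.1 + b * r.2) - r.2 * (a * p.1 + b * p.2) by ring.
    by rewrite lr lp !mulr0 subr0.
  have -> : b * (r.1 * p.2 - r.2 * p.1) =
      r.1 * (a * p.1 + b * p.2) - p.1 * (a * r.1 + b * r.2) by ring.
  by rewrite lr lp !mulr0 subr0.
have [r1|r1] := eqVneq r.1 0.
  have r2 : r.2 != 0 by apply: contraNneq r0; case: r r1 {fr lr e} => ? ? /= -> ->.
  apply: (mulfI r2); rewrite mulr0.
  have -> : r.2 * (a * p.1 + b * p.2) =
     p.2 * (a * r.1 + b * r.2) - a * (r.1 * p.2 - r.2 * p.1) by ring.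
  by rewrite lr e subrr !mulr0 subr0.
apply: (mulfI r1); rewrite mulr0.
have -> : r.1 * (a * p.1 + b * p.2) =
     p.1 * (a * r.1 + b * r.2) + b * (r.1 * p.2 - r.2 * p.1) by ring.
by rewrite lr e subrr !mulr0 addr0.
Qed.

(** A linear form with a nonzero rational zero [r] is a constant [l] times the rational form
    [r.1 * p.2 - r.2 * p.1]. Hence [eta] equals [eta l] at each of the q^2 - q rational vectors
    where the form does not vanish. *)
Lemma sum_eta_lin_rat a b (r : L * L) :
  (a != 0) || (b != 0) -> r \in Fq2 -> r != 0 -> lin a b r = 0 ->
  exists l : L, [/\ l != 0, l * r.1 = b, l * r.2 = - a,
   (forall p, p \in Fq2 -> lin a b p != 0 -> eta (lin a b p) = eta l) &
   \sum_(p in Fq2) eta (lin a b p) = q%:Z * (q%:Z - 1) * eta l].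
Proof.
move=> ab0 fr r0 lr.
have [l [l1 l2]] : exists l, l * r.1 = b /\ l * r.2 = - a.
  move: lr; rewrite /lin => lr; have [e1|r1] := eqVneq r.1 0.
    have r2 : r.2 != 0 by apply: contraNneq r0; case: r e1 {fr lr} => ? ? /= -> ->.
    move/eqP: lr; rewrite e1 mulr0 add0r mulf_eq0 (negPf r2) orbF => /eqP ->.
    by exists (- a / r.2); rewrite divfK // mulr0.
  exists (b / r.1); rewrite divfK //; split=> //; apply: (mulIf r1).
  rewrite mulrAC divfK //; apply/eqP; rewrite mulNr -subr_eq0 opprK addrC.
  by rewrite lr.
have l0 : l != 0.
  apply: contraTneq ab0 => l0; move: l1 l2; rewrite l0 !mul0r => <- /esym/eqP.
  by rewrite oppr_eq0 => ->; rewrite eqxx.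
have fl p : p \in Fq2 -> lin a b p != 0 -> eta (lin a b p) = eta l.
  have -> : lin a b p = (r.1 * p.2 - r.2 * p.1) * l.
    have -> : a = - (l * r.2) by rewrite l2 opprK.
    by rewrite /lin -l1; ring.
  move: fr; rewrite !Fq2E => /andP[? ?] /andP[? ?].
  rewrite mulf_eq0 (negPf l0) orbF => n0; rewrite eta_FqM //.
  by rewrite FqB ?FqM.
exists l; split=> //.
(* The bracket is the indicator of the nonzeros of the form: all vectors except 0 and those of
   [line r]. *)
rewrite (eq_bigr (fun p => (1 - (p == 0)%:R * 1 - (p \in line r)%:R * 1) * eta l));
  last first.
  move=> p fp; have := lin_zeros ab0 fr r0 lr fp.
  have [p0|p0] := eqVneq (lin a b p) 0.
    rewrite p0 eta0; have [->|_] /= := eqVneq p 0.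
      by move=> _; rewrite line0 //=; ring.
    by move=> <-; rewrite /=; ring.
  by rewrite fl //; case: eqP => //= _ <-; rewrite /=; ring.
rewrite -mulr_suml !big_split /= !sumrN (sum_pt0 sig (fun=> 1)).
rewrite (@sum_line r (fun=> 1)) // sumr_const (card_Fq2 oddq cardL sigE) natz.
by rewrite -mulnn PoszM; ring.
Qed.

(** The case of at most one further rational point on the conic. As [(b, - a)] spans the zeros of
    [l], the condition on [m (b, - a)] says that [l] and [m] have no common projective zero, which
    is nonsingularity of the conic. *)
Lemma good_counts_few_points (a b m0 m1 m2 : L) :
  let l := lin a b in let m := quad m0 m1 m2 in
  (a != 0) || (b != 0) -> m (b, - a) != 0 ->
  (forall p, p \in Fq2 -> ~~ rat_ratio (l p) (m p)) \/
  (exists2 r, (r \in Fq2) && (r != 0) &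
    forall p, p \in Fq2 -> rat_ratio (l p) (m p) = (p \in line r)) ->
  good_counts q
    (eta (m (b, - a)) * \sum_(p in Fq2) \sum_(x in Fq) eta (x * l p + m p))
    (\sum_(p in Fq2) \sum_(x in Fq) (x * l p + m p == 0)%:R).
Proof.
move=> l m ab0 c0 Hrho.
(* [n] is the number of directions leading to a second rational point, and [e] the value of [eta] of
   [l] there, or 0 if there is none. *)
have [n [e [ne Srho Sn]]] : exists n : nat, exists e : int,
  [/\ [\/ n = 0%N /\ e = 0 | n = 1%N /\ exists p, [/\ p \in Fq2, l p != 0 & e = eta (l p)]],
   \sum_(p in Fq2) (rat_ratio (l p) (m p))%:R * eta (l p) = (q%:Z - 1) * e
   & \sum_(p in Fq2) (rat_ratio (l p) (m p))%:R = (q%:Z - 1) * n%:Z].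
  case: Hrho => [H0|[r /andP[fr r0] Hr]].
    exists 0%N, 0; split; first by left.
      by rewrite mulr0 big1 // => p /H0/negPf->; rewrite mul0r.
    by rewrite mulr0 big1 // => p /H0/negPf->.
  have rr : r \in line r.
    by rewrite lineE // mulrC.
  exists 1%N, (eta (l r)); split.
  - by right; split=> //; exists r; split=> //; move: rr; rewrite -Hr // => /andP[].
  - rewrite -(@sum_line r (eta \o l)) //; last by move=> s fs s0; apply: eta_lin_scale.
    by apply: eq_bigr => p fp; rewrite Hr.
  - rewrite mulr1 -(sum_line_1 fr r0).
    by apply: eq_bigr => p fp; rewrite Hr.
rewrite sum_eta_dir sum_zero_dir Srho Sn.
(* The tangent at the base point is [l = 0]; the cases are whether this line contains a second point
   of PG(2,q). *)
have [|inj0] := boolP [exists r in Fq2, (r != 0) && (l r == 0)].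
  case/exists_inP=> r fr /andP[r0 /eqP lr].
  have [u [u0 u1 u2 fu ->]] := sum_eta_lin_rat ab0 fr r0 lr.
  have mE : m (b, - a) = u ^+ 2 * m r by rewrite /m /quad /= -u1 -u2; ring.
  have mr0 : m r != 0 by apply: contraNneq c0; rewrite mE => ->; rewrite mulr0.
  have -> : eta (m (b, - a)) = eta (m r) by rewrite mE etaM eta_sq // mul1r.
  have zE p : p \in Fq2 -> (l p == 0%R)%:R = (p == 0%R)%:R + (p \in line r)%:R :> int.
    move=> fp; rewrite /l (lin_zeros ab0 fr r0 lr fp).
    have [->|_] /= := eqVneq p 0; last by rewrite add0r.
    by rewrite line0 // addr0.
  have -> : \sum_(p in Fq2) (l p == 0)%:R * eta (m p) = (q%:Z - 1) * eta (m r).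
    rewrite (eq_bigr (fun p => (p == 0)%:R * eta (m p) + (p \in line r)%:R * eta (m p))).
      rewrite big_split /= (sum_pt0 sig (eta \o m)) (@sum_line r (eta \o m)) //=.
        by rewrite /m quad0 eta0 add0r.
      by move=> s fs s0; apply: eta_quad_scale.
    by move=> p fp; rewrite zE // mulrDl.
  have -> : \sum_(p in Fq2) (l p == 0%R)%:R * (m p == 0%R)%:R = 1 :> int.
    rewrite (eq_bigr (fun p : L * L => (p == 0)%:R)) ?(sum_pt0_1 sig) // => p fp.
    rewrite /l (lin_zeros ab0 fr r0 lr fp).
    have [->|p0] /= := eqVneq p 0; first by rewrite /m quad0 eqxx mulr1.
    have [|_] := boolP (p \in line r); last by rewrite mul0r.
    case/imsetP => s; rewrite !inE -FqE => /andP[s0 fs] ->.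
    have -> : m (s * r.1, s * r.2) = s ^+ 2 * m r by rewrite /m /quad /=; ring.
    by rewrite mulf_eq0 expf_eq0 /= (negPf s0) (negPf mr0) mulr0.
  case: ne => [[-> ->]|[-> [p [fp lp ->]]]].
    (* The sum is q (q - 1) (1 - eta u * eta (m r)). *)
    have [->|->] := eta_pm1 u0; have [->|->] := eta_pm1 mr0.
    - by exists 0%N, 2%N; split=> //; ring.
    - by exists 0%N, 4%N; split=> //; ring.
    - by exists 0%N, 4%N; split=> //; ring.
    - by exists 0%N, 2%N; split=> //; ring.
  (* The contribution of the second rational point cancels the sum of [eta (l p)]; only the tangent
     direction remains, with value 1 after multiplication by [eta (m r)]. *)
  rewrite (fu p) //; exists 1%N, 3%N.
  by have [->|->] := eta_pm1 u0; have [->|->] := eta_pm1 mr0; split=> //; ring.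
have lin_inj p : p \in Fq2 -> l p = 0 -> p = 0.
  move=> fp /eqP lp; apply/eqP; apply: contraNT inj0 => p0.
  by apply/exists_inP; exists p; rewrite // p0.
have S0 : \sum_(p in Fq2) eta (l p) = 0.
  by have [] := sum_Fq2_inj oddq cardL sigE lin_inj.
rewrite S0.
have zE p : p \in Fq2 -> (l p == 0) = (p == 0).
  by move=> fp; apply/eqP/eqP => [/(lin_inj p fp)//|->]; exact: lin0.
have -> : \sum_(p in Fq2) (l p == 0)%:R * eta (m p) = 0.
  transitivity ((eta \o m) 0); last by rewrite /= /m quad0 eta0.
  by rewrite -(sum_pt0 sig); apply: eq_bigr => p fp; rewrite zE.
have -> : \sum_(p in Fq2) (l p == 0%R)%:R * (m p == 0%R)%:R = 1 :> int.
  rewrite (eq_bigr (fun p : L * L => (p == 0)%:R)) ?(sum_pt0_1 sig) // => p fp.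
  rewrite zE //; have [->|p0] /= := eqVneq p 0; last by rewrite mul0r.
  by rewrite /m quad0 eqxx mulr1.
case: ne => [[-> ->]|[-> [p [fp lp ->]]]].
  by exists 0%N, 2%N; split=> //; ring.
(* Only the direction of the second point contributes, and the sum is q (q - 1) times the product of
   the two signs. *)
have [ep|ep] := eta_pm1 lp; have [em|em] := eta_pm1 c0; rewrite ep em.
- by exists 1%N, 3%N; split=> //; ring.
- by exists 1%N, 1%N; split=> //; ring.
- by exists 1%N, 1%N; split=> //; ring.
- by exists 1%N, 3%N; split=> //; ring.
Qed.

(** * Conics a xy + b xz + yz through a rational frame *)

Section Frame.
Variables a b : L.
Hypotheses (a0 : a != 0) (b0 : b != 0).
Let l := lin a b.
Let m := quad 0 1 0.
Let e1 : L * L := (1, 0).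
Let e2 : L * L := (0, 1).

Let e1Fq : e1 \in Fq2. Proof. by rewrite Fq2E Fq0 Fq1. Qed.
Let e2Fq : e2 \in Fq2. Proof. by rewrite Fq2E Fq0 Fq1. Qed.
Let e1n0 : e1 != 0. Proof. by rewrite xpair_eqE oner_eq0. Qed.
Let e2n0 : e2 != 0. Proof. by rewrite xpair_eqE oner_eq0 andbF. Qed.

(** Off the axes [m p] is a nonzero element of F_q, so [m p / l p] is rational exactly when [l p]
    is. *)
Definition third_direction (p : L * L) : bool :=
  [&& p.1 != 0, p.2 != 0, l p != 0 & l p \in Fq].

Lemma rat_ratio_frame p : p \in Fq2 ->
  (rat_ratio (l p) (m p))%:R =
  (p \in line e1)%:R + (p \in line e2)%:R + (third_direction p)%:R :> int.
Proof.
move=> fp; have [->|p0] := eqVneq p 0.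
  by rewrite !line0 // /third_direction /rat_ratio /l lin0 /= !eqxx.
rewrite !lineE // /third_direction /rat_ratio /l /lin /m /quad /=.
rewrite !mul1r !mul0r add0r addr0 [0 == p.1]eq_sym.
have [p1|p1] := eqVneq p.1 0; have [p2|p2] := eqVneq p.2 0.
- by case: p p1 p2 p0 {fp} => ? ? /= -> ->; rewrite eqxx.
- rewrite p1 mulr0 add0r mul0r mul0r Fq0 andbT mulf_neq0 //.
- rewrite p2 !mulr0 addr0 mul0r Fq0 andbT mulf_neq0 //.
- move: fp; rewrite Fq2E => /andP[f1 f2]; rewrite !add0r; congr _%:R; congr nat_of_bool.
  case: eqP => //= _; rewrite FqMl ?FqM ?mulf_neq0 //.
  by apply/idP/idP => /FqV; rewrite ?invrK.
Qed.

Lemma sum_rat_ratio_frame (w : int) :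
  \sum_(p in Fq2) (third_direction p)%:R * eta (l p) = (q%:Z - 1) * w ->
  \sum_(p in Fq2) (rat_ratio (l p) (m p))%:R * eta (l p) =
  (q%:Z - 1) * (eta a + eta b + w).
Proof.
move=> ew; rewrite (eq_bigr (fun p => (p \in line e1)%:R * (eta \o l) p +
   (p \in line e2)%:R * (eta \o l) p + (third_direction p)%:R * eta (l p))).
  rewrite !big_split /= (@sum_line e1 (eta \o l)) // ?(@sum_line e2 (eta \o l)) //;
    try by move=> s fs s0; apply: eta_lin_scale.
  by rewrite ew /= /l /lin /= !mulr1 !mulr0 addr0 add0r; ring.
by move=> p fp; rewrite rat_ratio_frame // !mulrDl.
Qed.

Lemma sum_rat_ratio_frame_1 (w : int) :
  \sum_(p in Fq2) (third_direction p)%:R = (q%:Z - 1) * w ->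
  \sum_(p in Fq2) (rat_ratio (l p) (m p))%:R = (q%:Z - 1) * (2%:Z + w).
Proof.
move=> ew; rewrite (eq_bigr (fun p => (p \in line e1)%:R +
   (p \in line e2)%:R + (third_direction p)%:R)).
  by rewrite !big_split /= !sum_line_1 // ew; ring.
by move=> p fp; rewrite rat_ratio_frame.
Qed.

(** The last hypothesis excludes a common zero of [l] and [m]. The summand [q] of the second count
    comes from p = 0, where every [x] is a zero: these are the multiples of the base point,
    including 0. The frame directions account for the 2. *)
Lemma frame_counts (E w n : int) :
  \sum_(p in Fq2) eta (l p) = E ->
  \sum_(p in Fq2) (third_direction p)%:R * eta (l p) = (q%:Z - 1) * w ->
  \sum_(p in Fq2) (third_direction p)%:R = (q%:Z - 1) * n ->
  (forall p, p \in Fq2 -> l p == 0 -> p != 0 -> m p != 0) ->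
  \sum_(p in Fq2) \sum_(x in Fq) eta (x * l p + m p) =
    - E + q%:Z * ((q%:Z - 1) * (eta a + eta b + w))
    + q%:Z * (\sum_(p in Fq2) (l p == 0)%:R * eta (m p)) /\
  \sum_(p in Fq2) \sum_(x in Fq) (x * l p + m p == 0)%:R =
    (q%:Z - 1) * (2%:Z + n) + q%:Z.
Proof.
move=> <- /sum_rat_ratio_frame ew /sum_rat_ratio_frame_1 en lm.
rewrite sum_eta_dir sum_zero_dir ew en; split=> //.
have -> : \sum_(p in Fq2) (l p == 0%R)%:R * (m p == 0%R)%:R = 1 :> int.
  rewrite (eq_bigr (fun p : L * L => (p == 0)%:R)) ?(sum_pt0_1 sig) // => p fp.
  have [->|p0] := eqVneq p 0; first by rewrite /l /m lin0 quad0 !eqxx mulr1.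
  have [lp|] := boolP (l p == 0); last by rewrite mul0r.
  by rewrite (negPf (lm _ fp lp p0)) mulr0.
by rewrite mulr1.
Qed.

Lemma eta_frame : eta (m (b, - a)) = eta a * eta b.
Proof.
rewrite -etaM -(etaN oddq cardL sigE) /m /quad /=; congr eta; ring.
Qed.

Hypothesis ab_nrat : ~~ ((a \in Fq) && (b \in Fq)).

(** The case where the tangent at the base point has no rational direction: [l] is injective on
    [Fq2], so only the two frame directions and a possible third one contribute. *)
Lemma good_counts_frame_inj :
  (forall p, p \in Fq2 -> l p = 0 -> p = 0) ->
  ((forall p, p \in Fq2 -> third_direction p = false) /\ (eta a = 1 \/ eta b = 1)) \/
  (exists2 r, (r \in Fq2) && (r != 0) & (eta (l r) = 1) /\
    forall p, p \in Fq2 -> third_direction p = (p \in line r)) ->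
  good_counts q
    (eta (m (b, - a)) * \sum_(p in Fq2) \sum_(x in Fq) eta (x * l p + m p))
    (\sum_(p in Fq2) \sum_(x in Fq) (x * l p + m p == 0)%:R).
Proof.
move=> l_inj H.
have S0 : \sum_(p in Fq2) eta (l p) = 0.
  by have [] := sum_Fq2_inj oddq cardL sigE l_inj.
have lm p : p \in Fq2 -> l p == 0 -> p != 0 -> m p != 0.
  by move=> fp /eqP/(l_inj _ fp)->; rewrite eqxx.
have S1 : \sum_(p in Fq2) (l p == 0)%:R * eta (m p) = 0.
  transitivity ((eta \o m) 0); last by rewrite /= /m quad0 eta0.
  rewrite -(sum_pt0 sig); apply: eq_bigr => p fp /=.
  have [->|p0] := eqVneq p 0; first by rewrite /l lin0 eqxx.
  by case: eqP => // /(l_inj _ fp) p0'; rewrite p0' eqxx in p0.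
rewrite eta_frame; case: H => [[H ab1]|[r /andP[fr r0] [lr1 Hr]]].
  have T1 : \sum_(p in Fq2) (third_direction p)%:R * eta (l p) = (q%:Z - 1) * 0.
    by rewrite mulr0 big1 // => p /H->; rewrite mul0r.
  have T2 : \sum_(p in Fq2) (third_direction p)%:R = (q%:Z - 1) * 0.
    by rewrite mulr0 big1 // => p /H->.
  have [-> ->] := frame_counts S0 T1 T2 lm; rewrite S1.
  (* The normalized sum is eta a + eta b; the value -2 is excluded by [ab1]. *)
  have [ea|ea] := eta_pm1 a0; have [eb|eb] := eta_pm1 b0; rewrite ea eb.
  - by exists 2%N, 4%N; split=> //; ring.
  - by exists 2%N, 2%N; split=> //; ring.
  - by exists 2%N, 2%N; split=> //; ring.
  - by move: ab1; rewrite ea eb => -[].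
have T1 : \sum_(p in Fq2) (third_direction p)%:R * eta (l p) = (q%:Z - 1) * 1.
  have := @sum_line r (eta \o l) fr r0 (fun s => @eta_lin_scale a b s r).
  by rewrite /= lr1 => <-; apply: eq_bigr => p fp; rewrite Hr.
have T2 : \sum_(p in Fq2) (third_direction p)%:R = (q%:Z - 1) * 1.
  by rewrite mulr1 -(sum_line_1 fr r0); apply: eq_bigr => p fp; rewrite Hr.
have [-> ->] := frame_counts S0 T1 T2 lm; rewrite S1.
(* The normalized sum is eta a + eta b + eta a * eta b, that is 3 if both signs are 1 and -1
   otherwise. *)
have [->|->] := eta_pm1 a0; have [->|->] := eta_pm1 b0.
- by exists 3%N, 5%N; split=> //; ring.
- by exists 3%N, 1%N; split=> //; ring.
- by exists 3%N, 1%N; split=> //; ring.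
- by exists 3%N, 1%N; split=> //; ring.
Qed.

(** If one of [a], [b] is rational, [l p] is rational only on an axis, so there is no third
    direction and one sign is 1. If neither is rational, exactly one direction off the axes makes
    [l] rational; it is a third direction, or the tangent when [l] vanishes on it. *)
Lemma good_counts_frame :
  good_counts q
    (eta (m (b, - a)) * \sum_(p in Fq2) \sum_(x in Fq) eta (x * l p + m p))
    (\sum_(p in Fq2) \sum_(x in Fq) (x * l p + m p == 0)%:R).
Proof.
have [fa|fa] := boolP (a \in Fq).
  have fb : b \notin Fq by move: ab_nrat; rewrite fa.
  have lFq p : p \in Fq2 -> l p \in Fq -> p.2 = 0.
    rewrite Fq2E /l /lin => /andP[f1 f2] f; apply/eqP; apply: contraNT fb => p2.
    rewrite -(FqMl _ f2 p2); have -> : p.2 * b = l p - a * p.1 by rewrite /l /lin; ring.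
    by rewrite FqB ?FqM.
  apply: good_counts_frame_inj => [p fp lp|].
    have p2 : p.2 = 0 by apply: lFq; rewrite // lp Fq0.
    move: lp; rewrite /l /lin p2 mulr0 addr0 => /eqP; rewrite mulf_eq0 (negPf a0) /=.
    by case: p p2 {fp} => ? ? /= -> /eqP->.
  left; split; last by left; apply: eta_Fq.
  move=> p fp; apply/negP => /and4P[_ p2 _ /(lFq p fp) p2'].
  by rewrite p2' eqxx in p2.
have [fb|fb] := boolP (b \in Fq).
  have lFq p : p \in Fq2 -> l p \in Fq -> p.1 = 0.
    rewrite Fq2E /l /lin => /andP[f1 f2] f; apply/eqP; apply: contraNT fa => p1.
    rewrite -(FqMl _ f1 p1); have -> : p.1 * a = l p - b * p.2 by rewrite /l /lin; ring.
    by rewrite FqB ?FqM.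
  apply: good_counts_frame_inj => [p fp lp|].
    have p1 : p.1 = 0 by apply: lFq; rewrite // lp Fq0.
    move: lp; rewrite /l /lin p1 mulr0 add0r => /eqP; rewrite mulf_eq0 (negPf b0) /=.
    by case: p p1 {fp} => ? ? /= -> /eqP->.
  left; split; last by right; apply: eta_Fq.
  move=> p fp; apply/negP => /and4P[p1 _ _ /(lFq p fp) p1'].
  by rewrite p1' eqxx in p1.
(* As [b] is not rational, 1 and [b] form a basis of L over F_q; below, a = g + b k in this
   basis. *)
have [p0 fp0 aE] : exists2 p, p \in Fq2 & a = 1 * p.1 + b * p.2.
  have [|+ _] := @sum_Fq2_inj L q sig oddq cardL sigE 1 b; last by apply.
  case=> y z; rewrite Fq2E /= mul1r => /andP[fy fz] e.
  have z0 : z = 0.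
    apply/eqP; apply: contraNT fb => z0; rewrite -(FqMl _ fz z0).
    have -> : z * b = (y + b * z) - y by ring.
    by rewrite e add0r FqN.
  by move: e; rewrite z0 mulr0 addr0 => ->.
move: fp0 aE; case: p0 => g k; rewrite Fq2E /= mul1r => /andP[fg fk] aE.
have k0 : k != 0 by apply: contraNneq fa => k0; rewrite aE k0 mulr0 addr0.
(* The vector [r] cancels the [b]-component of [l], leaving [l r = g]. *)
pose r : L * L := (1, - k).
have fr : r \in Fq2 by rewrite Fq2E /= Fq1 FqN.
have r0 : r != 0 by rewrite xpair_eqE oner_eq0.
have lr : l r = g by rewrite /l /lin /= aE; ring.
have lE p : l p = g * p.1 + b * (k * p.1 + p.2) by rewrite /l /lin aE; ring.
have lFq p : p \in Fq2 -> p != 0 -> (l p \in Fq) = (p \in line r).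
  move=> fp p0; rewrite lineE // /r /= mul1r; move: (fp); rewrite Fq2E => /andP[f1 f2].
  apply/idP/eqP => [f|e]; last first.
    by rewrite lE e mulNr subrr mulr0 addr0 FqM.
  apply/eqP; rewrite -subr_eq0; apply: contraNT fb => n0.
  have fd : p.2 - - k * p.1 \in Fq by rewrite FqB ?FqM ?FqN.
  rewrite -(FqMl _ fd n0).
  have -> : (p.2 - - k * p.1) * b = l p - g * p.1 by rewrite lE; ring.
  by rewrite FqB ?FqM.
have [g0|g0] := eqVneq g 0; last first.
  have l_inj p : p \in Fq2 -> l p = 0 -> p = 0.
    move=> fp lp; apply/eqP; apply: contraT => p0.
    have := lFq p fp p0; rewrite lp Fq0 => /esym/imsetP[s]; rewrite !inE => /andP[s0 _] pE.
    move: lp; rewrite pE lE /= => /eqP; have -> : g * (s * 1) + b * (k * (s * 1) + s * - k) = g * s by ring.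
    by rewrite mulf_eq0 (negPf s0) (negPf g0).
  apply: good_counts_frame_inj => //; right; exists r; rewrite ?fr //.
  split; first by rewrite lr eta_Fq.
  move=> p fp; rewrite /third_direction; have [->|p0] := eqVneq p 0.
    by rewrite eqxx line0.
  rewrite lFq //; have [/imsetP[s]|] := boolP (p \in line r); last by rewrite !andbF.
  rewrite !inE => /andP[s0 _] pE.
  have -> : l p != 0 by apply: contraNneq p0 => /(l_inj p fp)->.
  by rewrite pE /= mulr1 mulrN oppr_eq0 mulf_eq0 negb_or s0 k0.
(* Now [r] is the direction of the tangent at the base point, and a = b k gives [eta a = eta b]. The
   tangent contributes [eta (- k) = 1], and the normalized sum comes out as 1 + eta b. *)
rewrite g0 in lr.
have abn0 : (a != 0) || (b != 0) by rewrite a0.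
have [u [u0 u1 u2 fu SE]] := sum_eta_lin_rat abn0 fr r0 lr.
have {}u1 : u = b by rewrite -u1 mulr1.
have ea : eta a = eta b.
  by rewrite aE g0 add0r mulrC eta_FqM.
have T p : p \in Fq2 -> third_direction p = false.
  move=> fp; apply/negP => /and4P[p1 p2 lp].
  have p0 : p != 0 by apply: contraNneq p1 => ->.
  by rewrite lFq // => pr; move: lp; rewrite (lin_zeros abn0 fr r0 lr fp) pr orbT.
have T1 : \sum_(p in Fq2) (third_direction p)%:R * eta (l p) = (q%:Z - 1) * 0.
  by rewrite mulr0 big1 // => p /T->; rewrite mul0r.
have T2 : \sum_(p in Fq2) (third_direction p)%:R = (q%:Z - 1) * 0.
  by rewrite mulr0 big1 // => p /T->.
have mr s : m (s * r.1, s * r.2) = - (s ^+ 2 * k) by rewrite /m /quad /=; ring.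
have lm p : p \in Fq2 -> l p == 0 -> p != 0 -> m p != 0.
  move=> fp; rewrite /l (lin_zeros abn0 fr r0 lr fp) => /orP[->//|].
  case/imsetP => s; rewrite !inE => /andP[s0 _] -> _.
  by rewrite mr oppr_eq0 mulf_neq0 ?expf_neq0.
have [-> ->] := frame_counts SE T1 T2 lm.
have -> : \sum_(p in Fq2) (l p == 0)%:R * eta (m p) = q%:Z - 1.
  rewrite (eq_bigr (fun p => (p == 0)%:R * eta (m p) + (p \in line r)%:R * eta (m p))).
    have mrE : m r = - k by rewrite /m /quad /=; ring.
    have := @sum_line r (eta \o m) fr r0 (fun s => @eta_quad_scale 0 1 0 s r).
    rewrite /= mrE eta_Fq ?mulr1 ?FqN ?oppr_eq0 // => Sr.
    by rewrite big_split /= Sr (sum_pt0 sig (eta \o m)) /= /m quad0 eta0 add0r.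
  move=> p fp; rewrite /l (lin_zeros abn0 fr r0 lr fp).
  have [->|p0] := eqVneq p 0; last by rewrite mul0r add0r.
  by rewrite /m quad0 eta0 !mulr0.
rewrite eta_frame ea u1; have [->|->] := eta_pm1 b0.
- by exists 2%N, 4%N; split=> //; ring.
- by exists 2%N, 2%N; split=> //; ring.
Qed.

End Frame.

End Cases.

(** * Quadratic forms in three variables *)

Definition o0 : 'I_3 := @Ordinal 3 0 isT.
Definition o1 : 'I_3 := @Ordinal 3 1 isT.
Definition o2 : 'I_3 := @Ordinal 3 2 isT.

Lemma ord3P (P : 'I_3 -> Prop) : P o0 -> P o1 -> P o2 -> forall i, P i.
Proof.
move=> P0 P1 P2 [[|[|[|//]]] Hi].
- by rewrite (_ : Ordinal Hi = o0) //; apply: val_inj.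
- by rewrite (_ : Ordinal Hi = o1) //; apply: val_inj.
- by rewrite (_ : Ordinal Hi = o2) //; apply: val_inj.
Qed.

Lemma sum3 (V : nmodType) (F : 'I_3 -> V) : \sum_i F i = F o0 + F o1 + F o2.
Proof.
rewrite !big_ord_recl big_ord0 addr0 addrA.
by congr (F _ + F _ + F _); apply: val_inj.
Qed.

Section Forms.
Variable R : comNzRingType.
Implicit Types (A B : 'M[R]_3) (u v : 'rV[R]_3).

Lemma det3 A : \det A =
  A o0 o0 * (A o1 o1 * A o2 o2 - A o1 o2 * A o2 o1)
  - A o0 o1 * (A o1 o0 * A o2 o2 - A o1 o2 * A o2 o0)
  + A o0 o2 * (A o1 o0 * A o2 o1 - A o1 o1 * A o2 o0).
Proof.
(* Indexing the entries by natural numbers identifies the different ordinals of equal value produced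
   by the expansions. *)
have [a aE] : exists a : nat -> nat -> R, forall i j, A i j = a i j.
  by exists (fun i j => A (inord i) (inord j)) => i j; rewrite !inord_val.
rewrite (expand_det_row _ o0) sum3 /cofactor !(expand_det_row _ ord0).
rewrite !big_ord_recl !big_ord0 /cofactor !det_mx11 !mxE !aE /= /bump /=.
ring.
Qed.

Definition qf B v : R := (v *m B *m v^T) 0 0.
Definition bf B u v : R := (u *m B *m v^T) 0 0.
Definition row3 (x y z : R) : 'rV[R]_3 := \row_(i < 3) [:: x; y; z]`_i.

Lemma qfE B v : qf B v = \sum_i \sum_j B i j * v 0 i * v 0 j.
Proof.
rewrite /qf mxE exchange_big /=; apply: eq_bigr => j _; rewrite !mxE mulr_suml.
by apply: eq_bigr => i _; rewrite [v 0 i * _]mulrC.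
Qed.

Lemma qf_mul B A v : qf (A *m B *m A^T) v = qf B (v *m A).
Proof. by rewrite /qf trmx_mul !mulmxA. Qed.

Lemma bf_mul B A u v : bf (A *m B *m A^T) u v = bf B (u *m A) (v *m A).
Proof. by rewrite /bf trmx_mul !mulmxA. Qed.

Lemma qfZ B (s : R) v : qf (s *: B) v = s * qf B v.
Proof. by rewrite /qf -scalemxAr -scalemxAl mxE. Qed.

Lemma bf_sym B u v : B^T = B -> bf B u v = bf B v u.
Proof.
move=> sB; rewrite /bf; transitivity ((u *m B *m v^T)^T 0 0); first by rewrite [RHS]mxE.
by rewrite !trmx_mul trmxK sB mulmxA.
Qed.

Lemma qf_scale B (s : R) v : qf B (s *: v) = s ^+ 2 * qf B v.
Proof. by rewrite /qf linearZ /= -scalemxAr -!scalemxAl !mxE mulrA. Qed.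

Lemma row3E v : row3 (v 0 o0) (v 0 o1) (v 0 o2) = v.
Proof. by apply/rowP; apply: ord3P; rewrite mxE. Qed.

Lemma symE (C : 'M[R]_3) i j : C^T = C -> C i j = C j i.
Proof. by move=> sC; rewrite -[in LHS]sC mxE. Qed.

Definition row3mx (u v w : 'rV[R]_3) : 'M[R]_3 :=
  \matrix_(i < 3) nth 0 [:: u; v; w] i.

Lemma bf_row3mx (B : 'M[R]_3) u v w i j :
  (row3mx u v w *m B *m (row3mx u v w)^T) i j =
  bf B (nth 0 [:: u; v; w] i) (nth 0 [:: u; v; w] j).
Proof.
rewrite /bf !mxE; apply: eq_bigr => k _; rewrite !mxE; congr (_ * _).
by apply: eq_bigr => h _; rewrite !mxE.
Qed.

End Forms.

(** * Rational coordinate changes and reduction to normal forms *)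

Section RationalForms.
Variables (L : finFieldType) (q : nat) (sig : {rmorphism L -> L}).
Hypothesis oddq : odd q.
Hypothesis cardL : #|L| = (q ^ 2)%N.
Hypothesis sigE : forall x, sig x = x ^+ q.
Local Notation eta := (@eta L).
Local Notation Fq := (Fq sig).
Local Notation Fq2 := (Fq2 sig).
Local Notation rat_ratio := (rat_ratio sig).
Local Notation line := (line sig).
Let oddL := odd_cardL oddq cardL.
Let etaM := etaM oddL.
Let eta_FqM := eta_FqM oddq cardL sigE.
Let etaN := etaN oddq cardL sigE.

(** Rationality as invariance under the Frobenius map passes at once to products, inverses and
    transposes. *)
Definition ratmx m n (A : 'M[L]_(m, n)) : bool := map_mx sig A == A.

Lemma ratmxP m n (A : 'M[L]_(m, n)) :
  reflect (forall i j, A i j \in Fq) (ratmx A).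
Proof.
apply: (iffP eqP) => [AE i j|H]; first by apply/FqP; rewrite -[in RHS]AE mxE.
by apply/matrixP => i j; rewrite mxE; apply/FqP.
Qed.

Lemma ratmxM m n p (A : 'M[L]_(m, n)) (B : 'M[L]_(n, p)) :
  ratmx A -> ratmx B -> ratmx (A *m B).
Proof. by rewrite /ratmx map_mxM => /eqP-> /eqP->. Qed.

Lemma ratmx_inv n (A : 'M[L]_n) : ratmx A -> ratmx (invmx A).
Proof. by rewrite /ratmx map_invmx => /eqP->. Qed.

Lemma ratmx_tr m n (A : 'M[L]_(m, n)) : ratmx A -> ratmx A^T.
Proof. by rewrite /ratmx -map_trmx => /eqP->. Qed.

Definition ratV : {set 'rV[L]_3} := [set v | ratmx v].

Lemma ratVE v : (v \in ratV) = ratmx v. Proof. by rewrite inE. Qed.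

Lemma ratV_row3 x y z :
  (row3 x y z \in ratV) = [&& x \in Fq, y \in Fq & z \in Fq].
Proof.
rewrite inE; apply/ratmxP/and3P => [H|[fx fy fz] i].
  by have := H 0 o0; have := H 0 o1; have := H 0 o2; rewrite !mxE.
by apply: ord3P; rewrite !mxE.
Qed.

(** The inner sum runs along the parallels to the first axis, where a form vanishing at (1,0,0) is
    affine in [x]. *)
Lemma sum_ratV (V : nmodType) (G : 'rV[L]_3 -> V) :
  \sum_(v in ratV) G v =
  \sum_(p in Fq2) \sum_(x in Fq) G (row3 x p.1 p.2).
Proof.
rewrite pair_big /= (reindex (fun r : (L * L) * L => row3 r.2 r.1.1 r.1.2)) /=.
  by apply: eq_bigl => -[[y z] x]; rewrite ratV_row3 Fq2E /= andbC.
exists (fun v => ((v 0 o1, v 0 o2), v 0 o0)) => [[[y z] x] _|v _] /=.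
  by rewrite !mxE.
exact: row3E.
Qed.

Definition good_form (B : 'M[L]_3) : Prop :=
  good_counts q (\sum_(v in ratV) eta (\det B * qf B v))
    (\sum_(v in ratV) (qf B v == 0)%:R).

Lemma sum_ratV_mul (V : nmodType) (A : 'M[L]_3) (G : 'rV[L]_3 -> V) :
  ratmx A -> A \in unitmx ->
  \sum_(v in ratV) G (v *m A) = \sum_(v in ratV) G v.
Proof.
move=> rA uA; rewrite [RHS](reindex (fun v => v *m A)) /=; last first.
  by exists (fun v => v *m invmx A) => v _; rewrite ?mulmxK ?mulmxKV.
apply: eq_bigl => v; rewrite !inE; apply/idP/idP => [rv|rv].
  exact: ratmxM.
by rewrite -[v](mulmxK uA) ratmxM // ratmx_inv.
Qed.

(** The factor [\det B] in the character sum changes by the square of [\det A], so the sum is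
    invariant under rational base change. *)
Lemma good_form_congr (A B : 'M[L]_3) :
  ratmx A -> A \in unitmx -> good_form (A *m B *m A^T) -> good_form B.
Proof.
move=> rA uA; rewrite /good_form.
rewrite -(sum_ratV_mul (fun v => eta (\det B * qf B v)) rA uA).
rewrite -(sum_ratV_mul (fun v => (qf B v == 0)%:R) rA uA).
under eq_bigr => v _ do rewrite qf_mul.
under [X in good_counts q _ X]eq_bigr => v _ do rewrite qf_mul.
suff e v : eta (\det (A *m B *m A^T) * qf B (v *m A)) = eta (\det B * qf B (v *m A)).
  by under eq_bigr => v _ do rewrite e.
rewrite !det_mulmx det_tr.
have dA : \det A != 0 by rewrite -unitfE -unitmxE.
have -> : \det A * \det B * \det A * qf B (v *m A) =
  \det A ^+ 2 * (\det B * qf B (v *m A)) by ring.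
by rewrite etaM eta_sq // mul1r.
Qed.

(** The determinant contributes [s ^+ 3] and the form [s], together the square [(s ^+ 2) ^+ 2]. *)
Lemma good_form_scale (B : 'M[L]_3) s :
  s != 0 -> good_form (s *: B) -> good_form B.
Proof.
move=> s0; rewrite /good_form.
under eq_bigr => v _ do rewrite qfZ detZ.
under [X in good_counts q _ X]eq_bigr => v _.
  rewrite qfZ mulf_eq0 (negPf s0) orFb; over.
suff e v : eta (s ^+ 3 * \det B * (s * qf B v)) = eta (\det B * qf B v).
  by under eq_bigr => v _ do rewrite e.
have -> : s ^+ 3 * \det B * (s * qf B v) = (s ^+ 2) ^+ 2 * (\det B * qf B v) by ring.
by rewrite etaM eta_sq ?expf_neq0 // mul1r.
Qed.

Section PointedForm.
Variable B : 'M[L]_3.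
Hypotheses (symB : B^T = B) (B00 : B o0 o0 = 0).
Let a := 2%:R * B o0 o1.
Let b := 2%:R * B o0 o2.
Let l := lin a b.
Let m := quad (B o1 o1) (2%:R * B o1 o2) (B o2 o2).

Lemma qf_pointed x p : qf B (row3 x p.1 p.2) = x * l p + m p.
Proof.
rewrite qfE !sum3 !mxE /= B00 (symE o1 o0) // (symE o2 o0) // (symE o2 o1) //.
rewrite /l /m /lin /quad /a /b; ring.
Qed.

Lemma det_pointed : 2%:R ^+ 2 * \det B = - m (b, - a).
Proof.
rewrite det3 B00 (symE o1 o0) // (symE o2 o0) // (symE o2 o1) //.
rewrite /l /m /lin /quad /a /b /=; ring.
Qed.

Lemma eta_det_pointed : eta (\det B) = eta (m (b, - a)).
Proof.
rewrite -[RHS]etaN -det_pointed etaM eta_sq ?mul1r //; exact: two_neq0.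
Qed.

Lemma good_form_pointed :
  good_counts q
    (eta (m (b, - a)) * \sum_(p in Fq2) \sum_(x in Fq) eta (x * l p + m p))
    (\sum_(p in Fq2) \sum_(x in Fq) (x * l p + m p == 0)%:R) ->
  good_form B.
Proof.
rewrite /good_form !sum_ratV mulr_sumr.
under eq_bigr => p _ do rewrite mulr_sumr.
move=> H; under eq_bigr => p _ do under eq_bigr => x _ do
  rewrite etaM eta_det_pointed qf_pointed.
by under [X in good_counts q _ X]eq_bigr => p _ do under eq_bigr => x _ do
  rewrite qf_pointed.
Qed.

End PointedForm.

Definition nrational (B : 'M[L]_3) : Prop :=
  forall s (B0 : 'M[L]_3), ratmx B0 -> B != s *: B0.

Lemma nrational_congr (A B : 'M[L]_3) : ratmx A -> A \in unitmx ->
  nrational B -> nrational (A *m B *m A^T).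
Proof.
move=> rA uA nB s B0 rB0.
have r0 : ratmx (invmx A *m B0 *m (invmx A)^T).
  by rewrite !ratmxM // ?ratmx_tr // ratmx_inv.
apply: contraNneq (nB s _ r0) => e.
rewrite scalemxAl scalemxAr -e !mulmxA mulVmx // mul1mx.
by rewrite trmx_inv -mulmxA mulmxV ?unitmx_tr // mulmx1.
Qed.

(** With zero diagonal the form is a combination of xy, xz and yz, with all coefficients nonzero
    because the determinant is their product up to a constant. *)
Lemma good_form_frame (B : 'M[L]_3) :
  B^T = B -> (forall i, B i i = 0) -> \det B != 0 -> nrational B -> good_form B.
Proof.
move=> sB dB detB nB; have n2 := two_neq0 oddL.
have dE : \det B = 2%:R * B o0 o1 * B o0 o2 * B o1 o2.
  by rewrite det3 !dB (symE o1 o0) // (symE o2 o0) // (symE o2 o1) //; ring.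
move: detB; rewrite dE !mulf_eq0 !negb_or => /andP[/andP[/andP[_ b01] b02] b12].
(* This factor makes the coefficient of yz equal to 1. *)
pose s := (2%:R * B o1 o2)^-1.
have s0 : s != 0 by rewrite invr_eq0 mulf_neq0.
have sE : 2%:R * (s * B o1 o2) = 1.
  by rewrite mulrCA mulVf ?mulf_neq0.
apply: (good_form_scale s0); apply: good_form_pointed.
- by rewrite linearZ /= sB.
- by rewrite mxE dB mulr0.
have -> : quad ((s *: B) o1 o1) (2%:R * (s *: B) o1 o2) ((s *: B) o2 o2) = quad 0 1 0.
  by rewrite !mxE !dB !mulr0 sE.
apply: good_counts_frame; rewrite ?mxE ?mulf_neq0 //.
(* If both remaining coefficients were rational, [s *: B] would be a rational matrix. *)
apply/negP => /andP[]; rewrite !(FqMl _ (Fq_nat sig 2) n2) => f01 f02.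
have f12 : s * B o1 o2 \in Fq by rewrite -(FqMl _ (Fq_nat sig 2) n2) sE Fq1.
have /negP[] : B != s^-1 *: (s *: B).
  apply: nB; apply/ratmxP => i j; rewrite mxE; move: j i.
  apply: ord3P; apply: ord3P; rewrite ?dB ?mulr0 ?Fq0 //.
  - by rewrite (symE o1 o0).
  - by rewrite (symE o2 o0).
  - by rewrite (symE o2 o1).
by rewrite scalerA mulVf // scale1r.
Qed.

(** Two independent directions leading to further rational points give, with the base point, a
    rational frame on the conic; otherwise at most one such direction exists. *)
Lemma good_form_rational_point (B : 'M[L]_3) :
  B^T = B -> B o0 o0 = 0 -> \det B != 0 -> nrational B -> good_form B.
Proof.
move=> sB B00 detB nB.
pose a := 2%:R * B o0 o1; pose b := 2%:R * B o0 o2.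
pose l := lin a b; pose m := quad (B o1 o1) (2%:R * B o1 o2) (B o2 o2).
have c0 : m (b, - a) != 0.
  rewrite -oppr_eq0 -det_pointed // mulf_neq0 // expf_neq0 //; exact: two_neq0.
have ab0 : (a != 0) || (b != 0).
  apply: contraNT c0; rewrite negb_or !negbK => /andP[/eqP-> /eqP->].
  by rewrite /m /quad /= oppr0 expr0n /= !mulr0 !addr0.
pose R := [set p in Fq2 | rat_ratio (l p) (m p)].
have R0 r : r \in R -> r != 0.
  by rewrite inE => /andP[_]; apply: contraTneq => ->; rewrite /rat_ratio /l lin0 eqxx.
have [/exists_inP[r rR /exists_inP[r' r'R rr']]|noframe] :=
  boolP [exists r in R, [exists r' in R, r' \notin line r]]; last first.
  apply: good_form_pointed => //; apply: good_counts_few_points => //.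
  have [R_0|[r rR]] := set_0Vmem R.
    left=> p fp; apply/negP => H.
    have : p \in R by rewrite inE fp.
    by rewrite R_0 inE.
  have fr : r \in Fq2 by move: rR; rewrite inE => /andP[].
  right; exists r; first by rewrite fr R0.
  move=> p fp; apply/idP/idP => [H|].
    apply: contraNT noframe => pr; apply/exists_inP; exists r => //.
    by apply/exists_inP; exists p => //; rewrite inE fp.
  case/imsetP => s; rewrite !inE -FqE => /andP[s0 fs] ->.
  move: rR; rewrite inE /rat_ratio => /andP[_ /andP[lr mr]].
  have -> : lin a b (s * r.1, s * r.2) = s * l r by rewrite /l /lin /=; ring.
  have -> : quad (B o1 o1) (2%:R * B o1 o2) (B o2 o2) (s * r.1, s * r.2) = s ^+ 2 * m r.
    by rewrite /m /quad /=; ring.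
  rewrite mulf_neq0 //=; have -> : s ^+ 2 * m r / (s * l r) = s * (m r / l r).
    by field; rewrite s0 lr.
  by rewrite FqM.
have [fr r'F] : r \in Fq2 /\ r' \in Fq2.
  by move: rR r'R; rewrite !inE => /andP[-> _] /andP[-> _].
(* The second intersection of the conic with the line through the base point in direction [p]. *)
pose pt (p : L * L) := row3 (- (m p / l p)) p.1 p.2.
have ptR p : p \in R -> (qf B (pt p) = 0) /\ (pt p \in ratV).
  rewrite inE /rat_ratio => /andP[fp /andP[lp mp]]; split.
    by rewrite qf_pointed // -/a -/b -/l -/m mulNr divfK // addNr.
  by move: fp; rewrite ratV_row3 Fq2E FqN.
have [q1 v1] := ptR r rR; have [q2 v2] := ptR r' r'R.
pose A := row3mx (row3 1 0 0) (pt r) (pt r').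
have rA : ratmx A.
  apply/ratmxP; apply: ord3P => j; rewrite mxE /=.
  - by apply/ratmxP; rewrite -ratVE ratV_row3 Fq0 Fq1.
  - by apply/ratmxP; rewrite -ratVE.
  - by apply/ratmxP; rewrite -ratVE.
have uA : A \in unitmx.
  rewrite unitmxE unitfE det3 !mxE /=.
  have -> : 1 * (r.1 * r'.2 - r.2 * r'.1) -
   0 * (- (m r / l r) * r'.2 - r.2 * - (m r' / l r')) +
   0 * (- (m r / l r) * r'.1 - r.1 * - (m r' / l r')) = r.1 * r'.2 - r.2 * r'.1 by ring.
  by rewrite subr_eq0 -(lineE fr r'F) ?R0.
have dA : \det A != 0 by rewrite -unitfE -unitmxE.
apply: (good_form_congr rA uA); apply: good_form_frame.
- by rewrite !trmx_mul trmxK sB mulmxA.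
- apply: ord3P; rewrite bf_row3mx //=.
  by have := qf_pointed sB B00 1 0; rewrite lin0 quad0 mulr0 addr0.
- by rewrite !det_mulmx det_tr !mulf_neq0.
- exact: nrational_congr.
Qed.

End RationalForms.

(** * Completing a vector to a basis, and normalized representatives *)

Section Completion.
Variable R : fieldType.

Lemma rV_neq0 n (x : 'rV[R]_n) : x != 0 -> exists i, x 0 i != 0.
Proof.
move=> x0; apply/existsP; apply: contraNT x0 => /existsPn H; apply/eqP/rowP => i.
by rewrite mxE; apply/eqP; rewrite -[_ == _]negbK H.
Qed.

(** Two standard basis vectors, ordered cyclically, make the determinant equal to a nonzero
    coordinate of [x]. Entries 0 and 1 keep the base change rational when [x] is. *)
Lemma complete_basis (x : 'rV[R]_3) : x != 0 ->
  exists u v : 'rV[R]_3, [/\ row3mx x u v \in unitmx,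
    forall j, (u 0 j == 0) || (u 0 j == 1) & forall j, (v 0 j == 0) || (v 0 j == 1)].
Proof.
move=> x0; have [i xi] := rV_neq0 x0.
have cases (c : seq R) : all (fun y => (y == 0) || (y == 1)) c -> size c = 3%N ->
    forall j : 'I_3, (c`_j == 0) || (c`_j == 1).
  by move=> /all_nthP H sc j; apply: H; rewrite sc.
move: i xi; apply: ord3P => xi.
- exists (row3 0 1 0), (row3 0 0 1); split=> [|j|j].
  + rewrite unitmxE unitfE det3 !mxE /=; apply: contraNneq xi => <-; apply/eqP; ring.
  + by rewrite mxE; apply: cases; rewrite //= !eqxx !orbT.
  + by rewrite mxE; apply: cases; rewrite //= !eqxx !orbT.
- exists (row3 0 0 1), (row3 1 0 0); split=> [|j|j].
  + rewrite unitmxE unitfE det3 !mxE /=; apply: contraNneq xi => <-; apply/eqP; ring.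
  + by rewrite mxE; apply: cases; rewrite //= !eqxx !orbT.
  + by rewrite mxE; apply: cases; rewrite //= !eqxx !orbT.
- exists (row3 1 0 0), (row3 0 1 0); split=> [|j|j].
  + rewrite unitmxE unitfE det3 !mxE /=; apply: contraNneq xi => <-; apply/eqP; ring.
  + by rewrite mxE; apply: cases; rewrite //= !eqxx !orbT.
  + by rewrite mxE; apply: cases; rewrite //= !eqxx !orbT.
Qed.

End Completion.

Section GoodForm.
Variables (L : finFieldType) (q : nat) (sig : {rmorphism L -> L}).
Hypothesis oddq : odd q.
Hypothesis cardL : #|L| = (q ^ 2)%N.
Hypothesis sigE : forall x, sig x = x ^+ q.
Local Notation Fq := (Fq sig).

(** A rational base change moves the given point of the conic to (1,0,0). *)
Lemma good_form_of_rational_zero (B : 'M[L]_3) (x : 'rV[L]_3) :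
  B^T = B -> \det B != 0 -> nrational sig B ->
  ratmx sig x -> x != 0 -> qf B x = 0 -> good_form q sig B.
Proof.
move=> sB dB nB rx x0 qx; have [u [v [uA u01 v01]]] := complete_basis x0.
have rA : ratmx sig (row3mx x u v).
  apply/ratmxP; apply: ord3P => j; rewrite mxE /=; first exact: (ratmxP _ _ rx).
    by case/orP: (u01 j) => /eqP->; rewrite ?Fq0 ?Fq1.
  by case/orP: (v01 j) => /eqP->; rewrite ?Fq0 ?Fq1.
apply: (good_form_congr oddq cardL rA uA).
apply: good_form_rational_point; rewrite ?sigE //.
- by rewrite !trmx_mul trmxK sB mulmxA.
- by rewrite bf_row3mx.
- by rewrite !det_mulmx det_tr !mulf_neq0 // -unitfE -unitmxE.
- exact: nrational_congr.
Qed.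

End GoodForm.

Definition vec (L : nzRingType) (v : {ffun 'I_3 -> L}) : 'rV[L]_3 := \row_i v i.

Lemma normalize (L : finFieldType) (v : 'rV[L]_3) : v != 0 ->
  exists i (w : {ffun 'I_3 -> L}),
    [/\ v 0 i != 0, normalized w & v = v 0 i *: vec w].
Proof.
move=> v0; have [i0 vi0] := rV_neq0 v0.
(* Normalization divides by the first nonzero coordinate. *)
pose i := [arg min_(i < i0 | v 0 i != 0) (i : nat)].
have [vi mini] : v 0 i != 0 /\ forall j, v 0 j != 0 -> (i <= j)%N.
  by rewrite /i; case: arg_minnP => // k vk mk; split.
exists i, [ffun k => (v 0 i)^-1 * v 0 k]; split=> //; last first.
  by apply/rowP => k; rewrite !mxE ffunE mulVKf.
apply/existsP; exists i; rewrite ffunE mulVf // eqxx /=.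
apply/forallP => j; apply/implyP => ji; rewrite ffunE mulf_eq0.
by apply/orP; right; apply: contraTT ji => /mini; rewrite -leqNgt.
Qed.

(** * Projective points and tangent lines *)

Section Projective.
Variables (L : finFieldType) (S : {set L}).
Hypothesis S0 : 0 \in S.
Hypothesis SM : forall x y, x \in S -> y \in S -> x * y \in S.
Hypothesis SV : forall x, x \in S -> x^-1 \in S.
Variable P : pred 'rV[L]_3.
Hypothesis PZ : forall s v, s \in S -> s != 0 -> P (s *: v) = P v.

(** A nonzero vector over [S] is uniquely a nonzero scalar times a normalized vector. This is
    applied with [S] the subfield, for points of PG(2,q), and with [S] all of L, for tangent
    lines. *)
Lemma card_normalized :
  #|[set v : 'rV[L]_3 | [forall i, v 0 i \in S] & (v != 0) && P v]| =
  ((#|S| - 1) * #|[set v : {ffun 'I_3 -> L} |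
      normalized v & [forall i, v i \in S] && P (vec v)]|)%N.
Proof.
set V := [set v : 'rV[L]_3 | _ & _]; set N := [set v : {ffun _} | _ & _].
have -> : (#|S| - 1 = #|S :\ 0%R|)%N by rewrite (cardsD1 0 S) S0 addKn.
rewrite -cardsX.
pose h (r : L * {ffun 'I_3 -> L}) := r.1 *: vec r.2.
have h_inj : {in setX (S :\ 0) N &, injective h}.
  move=> [s w] [s' w']; rewrite !in_setX !in_setD1 /=.
  move=> /andP[/andP[s0 _] Nw] /andP[/andP[s0' _] Nw'].
  move: Nw Nw'; rewrite !inE => /andP[/existsP[i /andP[/eqP wi /forallP wj]] _].
  move=> /andP[/existsP[i' /andP[/eqP wi' /forallP wj']] _].
  rewrite /h /= => /rowP e.
  have ek k : s * w k = s' * w' k by have := e k; rewrite !mxE.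
  have ii' : i = i'.
    apply: val_inj; case: (ltngtP i i') => // lt.
      have := ek i; rewrite wi mulr1 (eqP (implyP (wj' i) lt)) mulr0 => s_0.
      by rewrite s_0 eqxx in s0.
    have := ek i'; rewrite wi' mulr1 (eqP (implyP (wj i') lt)) mulr0 => s_0.
    by rewrite -s_0 eqxx in s0'.
  have ss : s = s' by have := ek i; rewrite wi ii' wi' !mulr1.
  rewrite ss; congr (_, _); apply/ffunP => k; apply: (mulfI s0').
  by rewrite -ek ss.
rewrite -(card_in_imset h_inj); apply: eq_card => v.
apply/idP/imsetP => [|[[s w]]]; last first.
  rewrite in_setX in_setD1 inE /= => /andP[/andP[s0 Ss]].
  case/and3P=> /existsP[i /andP[/eqP wi _]] /forallP Sw Pw ->.
  rewrite inE /h /= PZ // Pw andbT; apply/andP; split.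
    by apply/forallP => k; rewrite !mxE SM.
  apply: contraNneq s0 => /rowP/(_ i); rewrite !mxE wi mulr1 => ->; exact: eqxx.
rewrite inE => /and3P[/forallP Sv v0 Pv].
have [i [w [vi nw vE]]] := normalize v0.
exists (v 0 i, w) => //; rewrite in_setX in_setD1 inE /= vi Sv nw /=.
rewrite -(PZ _ (Sv i) vi) -vE Pv andbT; apply/forallP => k.
have -> : w k = (v 0 i)^-1 * v 0 k by rewrite [in v 0 k]vE !mxE mulKf.
by rewrite SM ?SV.
Qed.

End Projective.

(** * Zeros of a quadratic form on a polar line *)

Section Isotropic.
Variable L : finFieldType.
Hypothesis oddL : odd #|L|.

(** A nondegenerate binary form splits into two independent linear factors if its discriminant is a
    square, and has no nontrivial zero otherwise. *)
Lemma card_binary_zeros (g0 g1 g2 : L) : g1 ^+ 2 - g0 * g2 != 0 ->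
  #|[set p : L * L | (p != 0) && (quad g0 (2%:R * g1) g2 p == 0)]| =
  if is_square (g1 ^+ 2 - g0 * g2) then (2 * (#|L| - 1))%N else 0%N.
Proof.
have n2 := two_neq0 oddL.
move=> d0; have [|nsq] := ifPn; last first.
  apply: eq_card0 => -[s t]; rewrite inE; apply/negP => /andP[p0 /eqP].
  rewrite /quad /= => e; case/negP: nsq; apply/existsP.
  (* Completing the square exhibits the discriminant as a square when [t] is nonzero. *)
  have e2 : (g0 * s + g1 * t) ^+ 2 = (g1 ^+ 2 - g0 * g2) * t ^+ 2.
    have -> : (g0 * s + g1 * t) ^+ 2 = g0 * (g0 * s ^+ 2 + 2%:R * g1 * (s * t) + g2 * t ^+ 2)
      + (g1 ^+ 2 - g0 * g2) * t ^+ 2 by ring.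
    by rewrite e mulr0 add0r.
  have [t0|t0] := eqVneq t 0.
    have s0 : s != 0 by apply: contraNneq p0; rewrite t0 => ->.
    move/eqP: e; rewrite t0 mulr0 expr0n /= !mulr0 !addr0 mulf_eq0 expf_eq0 /= (negPf s0) orbF.
    by move/eqP => ->; exists g1; rewrite mul0r subr0.
  exists ((g0 * s + g1 * t) / t); rewrite expr_div_n e2 mulfK ?expf_neq0 //.
case/existsP=> d /eqP dE; have dn0 : d != 0.
  by apply: contraNneq d0; rewrite dE => ->; rewrite expr0n.
have [r [r' [r0 r0' rr' qE]]] : exists r r' : L * L,
  [/\ r != 0, r' != 0, r.1 * r'.2 - r.2 * r'.1 != 0 &
   exists2 k, k != 0 & forall p, k * quad g0 (2%:R * g1) g2 p =
     (r.1 * p.2 - r.2 * p.1) * (r'.1 * p.2 - r'.2 * p.1)].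
  have [g00|g00] := eqVneq g0 0.
    have g1n0 : g1 != 0.
      by apply: contraNneq d0 => ->; rewrite g00 mul0r subr0 expr0n.
    exists (1, 0), (- g2, 2%:R * g1); rewrite !xpair_eqE oner_eq0 /=; split=> //.
    - by rewrite [X in _ && X](negPf (mulf_neq0 n2 g1n0)) andbF.
    - by rewrite mul1r mul0r subr0 mulf_neq0.
    exists (- 1); first by rewrite oppr_eq0 oner_eq0.
    by move=> p; rewrite /quad g00; ring.
  exists (- g1 + d, g0), (- g1 - d, g0); rewrite !xpair_eqE (negPf g00) !andbF /=; split=> //.
    have -> : (- g1 + d) * g0 - g0 * (- g1 - d) = 2%:R * d * g0 by ring.
    by rewrite !mulf_neq0.
  exists g0 => // p; rewrite /quad.
  have -> : ((- g1 + d) * p.2 - g0 * p.1) * ((- g1 - d) * p.2 - g0 * p.1) =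
     g0 ^+ 2 * p.1 ^+ 2 + 2%:R * g0 * g1 * (p.1 * p.2) + (g1 ^+ 2 - d ^+ 2) * p.2 ^+ 2 by ring.
  by rewrite -dE; ring.
case: qE => k k0 qE.
pose sp (u : L * L) := [set (s * u.1, s * u.2) | s in [set~ (0 : L)]].
have spE u p : u != 0 -> p != 0 -> (p \in sp u) = (u.1 * p.2 - u.2 * p.1 == 0).
  move=> u0 p0; apply/imsetP/eqP => [[s _ ->]|/eqP]; first by rewrite /=; ring.
  rewrite subr_eq0 => /eqP/(proportional_pair u0 p0)[s s0 ->].
  by exists s; rewrite ?inE.
have spn0 u p : u != 0 -> p \in sp u -> p != 0.
  by move=> u0 /imsetP[s]; rewrite !inE => s0 ->; apply: scale_pair_neq0.
have card_sp u : u != 0 -> #|sp u| = (#|L| - 1)%N.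
  by move=> u0; rewrite card_imset ?cardsC1 ?subn1 //; apply: scale_pair_inj.
have -> : [set p : L * L | (p != 0) && (quad g0 (2%:R * g1) g2 p == 0)] = sp r :|: sp r'.
  apply/setP => p; rewrite in_setU inE.
  have [->|p0] /= := eqVneq p 0.
    have n0 u : u != 0 -> (0 \in sp u) = false.
      by move=> u0; apply/negP => /(spn0 _ _ u0); rewrite eqxx.
    by rewrite !n0.
  by rewrite !spE // -mulf_eq0 -qE mulf_eq0 (negPf k0).
rewrite cardsU (_ : sp r :&: sp r' = set0) ?cards0 ?subn0 ?card_sp ?mul2n ?addnn //.
apply/setP => p; rewrite !inE; apply/negP => /andP[pr].
have p0 := spn0 _ _ r0 pr; rewrite spE // => /eqP e.
case/imsetP: pr => s; rewrite !inE => s0 pE; case/negP: rr'.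
have : s * (r.1 * r'.2 - r.2 * r'.1) == 0.
  by rewrite -oppr_eq0 -e pE /=; apply/eqP; ring.
by rewrite mulf_eq0 (negPf s0).
Qed.

(* The zeros of the form on the polar line of x are the points of contact of
   the tangents through x. *)
Lemma card_polar_zeros (B : 'M[L]_3) (x : 'rV[L]_3) :
  B^T = B -> \det B != 0 -> qf B x != 0 ->
  #|[set w : 'rV[L]_3 | (w != 0) && ((qf B w == 0) && (bf B x w == 0))]| =
  if is_square (- \det B * qf B x) then (2 * (#|L| - 1))%N else 0%N.
Proof.
move=> sB dB qx; have x0 : x != 0.
  by apply: contraNneq qx => ->; rewrite /qf !mul0mx mxE.
have [u [v [uA _ _]]] := complete_basis x0; set A := row3mx x u v in uA.
have dA : \det A != 0 by rewrite -unitfE -unitmxE.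
have [C CE] : {C | C = A *m B *m A^T} by exists (A *m B *m A^T).
have sC : C^T = C by rewrite CE !trmx_mul trmxK sB mulmxA.
have C00 : C o0 o0 = qf B x by rewrite CE bf_row3mx.
have c0 : C o0 o0 != 0 by rewrite C00.
(* In the basis starting with [x], the polar line is parametrized by solving its equation for the
   first coordinate. *)
pose w1 (p : L * L) : 'rV[L]_3 :=
  row3 (- (C o0 o1 * p.1 + C o0 o2 * p.2) / C o0 o0) p.1 p.2.
(* The Schur complement of the entry [C o0 o0]: the Gram matrix of the form on the polar line. *)
pose G i j := C i j - C o0 i * C o0 j / C o0 o0.
have w1E p : qf C (w1 p) = quad (G o1 o1) (2%:R * G o1 o2) (G o2 o2) p.
  rewrite qfE !sum3 !mxE /= (symE o1 o0) // (symE o2 o0) // (symE o2 o1) //.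
  by rewrite /quad /G; field.
have dC : \det C = \det A ^+ 2 * \det B by rewrite CE !det_mulmx det_tr; ring.
have dG : G o1 o2 ^+ 2 - G o1 o1 * G o2 o2 = - \det C / C o0 o0.
  rewrite det3 (symE o1 o0) // (symE o2 o0) // (symE o2 o1) //.
  by rewrite /G; field.
have dG0 : G o1 o2 ^+ 2 - G o1 o1 * G o2 o2 != 0.
  by rewrite dG mulf_neq0 ?invr_eq0 // oppr_eq0 dC mulf_neq0 ?expf_neq0.
have sqE : is_square (- \det B * qf B x) = is_square (G o1 o2 ^+ 2 - G o1 o1 * G o2 o2).
  rewrite dG dC C00.
  have k0 : \det A / qf B x != 0 by rewrite mulf_neq0 ?invr_eq0.
  have -> : - (\det A ^+ 2 * \det B) / qf B x =
     (\det A / qf B x) ^+ 2 * (- \det B * qf B x) by field.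
  apply/existsP/existsP => -[y /eqP yE].
    by exists (\det A / qf B x * y); rewrite yE -exprMn.
  exists (y / (\det A / qf B x)); apply/eqP; apply: (mulfI (expf_neq0 2 k0)).
  by rewrite yE -exprMn mulrC divfK.
rewrite sqE -card_binary_zeros //.
have A_inj : injective (fun p => w1 p *m A).
  move=> [y z] [y' z'] /(can_inj (mulmxK uA))/rowP e.
  by have := e o1; have := e o2; rewrite !mxE /= => -> ->.
rewrite -[RHS](card_imset _ A_inj); apply: eq_card => w; rewrite inE.
have bC (t : 'rV[L]_3) : bf B x (t *m A) = C o0 o0 * t 0 o0 + C o0 o1 * t 0 o1 + C o0 o2 * t 0 o2.
  have xE : x = row3 1 0 0 *m A.
    by apply/rowP => j; rewrite !mxE sum3 !mxE /= mul1r !mul0r !addr0.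
  rewrite [in bf _ x]xE -bf_mul -CE /bf !mxE sum3 !mxE !sum3 !mxE /=.
  by rewrite !mul0r !addr0 !mul1r.
apply/idP/imsetP => [/and3P[w0 qw bw]|[p]].
  pose t := w *m invmx A; have wE : w = t *m A by rewrite mulmxKV.
  have t1 : t = w1 (t 0 o1, t 0 o2).
    rewrite -[LHS]row3E /w1 /=; congr row3; apply: (mulIf c0); rewrite divfK //.
    apply/eqP; rewrite -subr_eq0 opprK; move: bw; rewrite wE bC => /eqP <-.
    by apply/eqP; ring.
  exists (t 0 o1, t 0 o2); last by rewrite -t1.
  rewrite inE -w1E -t1 CE qf_mul -wE qw andbT.
  apply: contraNneq w0 => -[e1 e2]; rewrite wE t1 e1 e2.
  apply/eqP; rewrite -[RHS](mul0mx _ A); congr (_ *m _).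
  apply/rowP; apply: ord3P; rewrite !mxE //=.
  by rewrite !mulr0 addr0 oppr0 mul0r.
rewrite inE => /andP[p0 qp] ->; rewrite -qf_mul -CE w1E qp bC /w1 !mxE /=.
apply/andP; split; last by apply/eqP; field.
apply: contraNneq p0 => e; have : w1 p = 0.
  by rewrite -[w1 p](mulmxK uA) e mul0mx.
by case: p {qp e} => y z /rowP e; have := e o1; have := e o2; rewrite !mxE /= => -> ->.
Qed.

End Isotropic.

(** * Quadratic polynomials and their Gram matrices *)

Lemma mnm_UD_eq (i j a b : 'I_3) :
  ((U_(i) + U_(j))%MM == (U_(a) + U_(b))%MM) =
  ((i == a) && (j == b)) || ((i == b) && (j == a)).
Proof.
apply/eqP/idP => [/mnmP H|].
  move: (H o0) (H o1) (H o2); rewrite !mnmDE !mnm1E.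
  by move: b a j i {H}; do 4!apply: ord3P.
by case/orP=> /andP[/eqP-> /eqP->] //; rewrite addmC.
Qed.

Lemma mdeg2P (m : 'X_{1..3}) : mdeg m = 2%N -> exists i j, m = (U_(i) + U_(j))%MM.
Proof.
move=> dm.
have [i mi] : exists i, (0 < m i)%N.
  apply/existsP; apply: contraPT dm => /existsPn H; rewrite mdegE.
  by rewrite big1 // => i _; apply/eqP; rewrite -leqn0 leqNgt H.
have Um : (U_(i) <= m)%MM.
  by apply/mnm_lepP => k; rewrite mnm1E; case: eqP => // <-.
have : mdeg (m - U_(i))%MM == 1%N.
  by have := dm; rewrite -{1}(submK Um) mdegD mdeg1 addn1 => -[->].
rewrite mdeg_eq1 => /existsP[j /eqP mE]; exists j, i.
by rewrite -mE submK.
Qed.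

Section QuadraticPolynomials.
Variable R : comNzRingType.

Definition qpoly (B : 'M[R]_3) : {mpoly R[3]} :=
  \sum_i \sum_j B i j *: ('X_i * 'X_j).

Lemma mcoeff_qpoly (B : 'M[R]_3) m :
  (qpoly B)@_m = \sum_i \sum_j B i j * ((U_(i) + U_(j))%MM == m)%:R.
Proof.
rewrite /qpoly raddf_sum /=; apply: eq_bigr => i _.
rewrite raddf_sum /=; apply: eq_bigr => j _.
by rewrite mcoeffZ -mpolyXD mcoeffX.
Qed.

Lemma meval_qpoly (B : 'M[R]_3) (v : {ffun 'I_3 -> R}) :
  (qpoly B).@[v] = qf B (vec v).
Proof.
rewrite qfE /qpoly raddf_sum /=; apply: eq_bigr => i _.
rewrite raddf_sum /=; apply: eq_bigr => j _.
by rewrite mevalZ mevalM !mevalXU !mxE mulrA.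
Qed.

Lemma mderiv_qpoly (B : 'M[R]_3) (v : {ffun 'I_3 -> R}) k : B^T = B ->
  ((qpoly B)^`M(k)).@[v] = 2%:R * (vec v *m B) 0 k.
Proof.
move=> sB; have dX i j : ((('X_i * 'X_j : {mpoly R[3]})^`M(k)).@[v]) =
    (i == k)%:R * v j + v i * (j == k)%:R.
  rewrite mderivM !mderivX !mnm1E mevalD !mevalM !mevalXU !mevalZ.
  have e0 (h : 'I_3) : (h == k)%:R * ('X_[(U_(h) - U_(k))]).@[v] = (h == k)%:R.
    have [->|_] := eqVneq h k; last by rewrite mul0r.
    have -> : (U_(k) - U_(k))%MM = 0%MM.
      by apply/mnmP => s; rewrite mnmBE subnn mnm0E.
    by rewrite mpolyX0 meval1 mulr1.
  by rewrite !e0.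
rewrite mxE /qpoly !sum3 !mderivD !mderivZ !mevalD !mevalZ !dX !mxE.
move: k {dX}; apply: ord3P;
  rewrite /= (symE o1 o0) // (symE o2 o0) // (symE o2 o1) //; ring.
Qed.

End QuadraticPolynomials.

Definition gram (R : fieldType) (F : {mpoly R[3]}) : 'M[R]_3 :=
  \matrix_(i, j) (F@_(U_(i) + U_(j)) / (if i == j then 1 else 2%:R)).

Lemma gram_sym (R : fieldType) (F : {mpoly R[3]}) : (gram F)^T = gram F.
Proof. by apply/matrixP => i j; rewrite !mxE addmC eq_sym. Qed.

Lemma qpoly_gram (R : fieldType) (F : {mpoly R[3]}) :
  2%:R != 0 :> R -> F \is 2.-homog -> F = qpoly (gram F).
Proof.
move=> n2 hF; apply/mpolyP => m; rewrite mcoeff_qpoly.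
have [/eqP dm|dm] := boolP (mdeg m == 2%N); last first.
  rewrite memN_msupp_eq0; last first.
    by apply: contra dm => /(dhomog_mf hF)/eqP.
  rewrite big1 // => i _; rewrite big1 // => j _; rewrite (_ : _ == _ = false) ?mulr0 //.
  by apply: contraNF dm => /eqP <-; rewrite mdegD !mdeg1.
have [c [cE cC]] : exists c : 'I_3 -> 'I_3 -> R,
    (forall i j, F@_(U_(i) + U_(j)) = c i j) /\ (forall i j, c i j = c j i).
  by exists (fun i j => F@_(U_(i) + U_(j))); split=> // i j; rewrite addmC.
have [a [b ->]] := mdeg2P dm.
rewrite !sum3 !mnm_UD_eq !mxE !cE; move: b a.
by do 2!apply: ord3P; rewrite /= ?(cC o1 o0) ?(cC o2 o0) ?(cC o2 o1); field;
  rewrite ?oner_eq0 ?n2.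
Qed.

(** * Products of linear forms *)

Section Factorization.
Variable R : comNzRingType.

Definition lpoly (u : 'cV[R]_3) : {mpoly R[3]} := \sum_i u i 0 *: 'X_i.

Lemma lpolyM (u v : 'cV[R]_3) : lpoly u * lpoly v = qpoly (u *m v^T).
Proof.
rewrite /lpoly /qpoly mulr_suml; apply: eq_bigr => i _.
rewrite mulr_sumr; apply: eq_bigr => j _.
by rewrite !mxE big_ord1 !mxE -scalerAl -scalerAr scalerA.
Qed.

Lemma mcoeff_lpoly (u : 'cV[R]_3) i : (lpoly u)@_U_(i) = u i 0.
Proof.
rewrite /lpoly raddf_sum /= (bigD1 i) //= mcoeffZ mcoeffXU eqxx mulr1.
by rewrite big1 ?addr0 // => j /negPf ji; rewrite mcoeffZ mcoeffXU ji mulr0.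
Qed.

Lemma lpoly_const (u : 'cV[R]_3) : (msize (lpoly u) <= 1)%N -> u = 0.
Proof.
move=> /msize1_polyC e; apply/colP => i; rewrite mxE -mcoeff_lpoly e mcoeffC.
by rewrite -mdeg_eq0 mdeg1 mulr0.
Qed.

Lemma qpolyD (A B : 'M[R]_3) : qpoly (A + B) = qpoly A + qpoly B.
Proof.
rewrite /qpoly -big_split; apply: eq_bigr => i _ /=.
by rewrite -big_split; apply: eq_bigr => j _ /=; rewrite mxE scalerDl.
Qed.

Lemma qpolyZ s (B : 'M[R]_3) : qpoly (s *: B) = s *: qpoly B.
Proof.
rewrite /qpoly scaler_sumr; apply: eq_bigr => i _.
by rewrite scaler_sumr; apply: eq_bigr => j _; rewrite mxE scalerA.
Qed.

Lemma qpoly_tr (B : 'M[R]_3) : qpoly B^T = qpoly B.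
Proof.
rewrite /qpoly exchange_big /=; apply: eq_bigr => i _.
by apply: eq_bigr => j _; rewrite mxE mulrC.
Qed.

End Factorization.

(** A quadratic polynomial depends only on the symmetric part of its matrix, once 2 is
    invertible. *)
Lemma qpoly_eq (K : fieldType) (A B : 'M[K]_3) :
  2%:R != 0 :> K -> A + A^T = B + B^T -> qpoly A = qpoly B.
Proof.
move=> n2 /(congr1 (@qpoly K)); rewrite !qpolyD !qpoly_tr.
have half (p : {mpoly K[3]}) : 2%:R^-1 *: (p + p) = p.
  by rewrite -mulr2n -scaler_nat scalerA mulVf // scale1r.
by move/(congr1 (fun p => 2%:R^-1 *: p)); rewrite !half.
Qed.

Lemma map_qpoly (R S : comNzRingType) (f : {rmorphism R -> S}) (B : 'M[R]_3) :
  map_mpoly f (qpoly B) = qpoly (map_mx f B).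
Proof.
apply/mpolyP => m; rewrite mcoeff_map_mpoly !mcoeff_qpoly raddf_sum /=.
apply: eq_bigr => i _; rewrite raddf_sum /=; apply: eq_bigr => j _.
by rewrite rmorphM /= rmorph_nat mxE.
Qed.

Lemma closed_sqrt (K : closedFieldType) (x : K) : exists y, y ^+ 2 = x.
Proof.
have [y yE] := @solve_monicpoly K 2 (fun i => if i == 0%N then x else 0) isT.
by exists y; rewrite yE !big_ord_recl big_ord0 /= mulr1 mul0r !addr0.
Qed.

(** * Absolutely irreducible forms are nonsingular *)

Section Irreducible.
Variables (L : finFieldType) (F : {mpoly L[3]}).
Hypothesis n2 : 2%:R != 0 :> L.
Hypothesis hF : F \is 2.-homog.
Hypothesis F0 : F != 0.
Hypothesis irrF : abs_irreducible F.

(** A kernel vector of the Gram matrix, taken as first basis vector, removes one variable. The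
    remaining binary form factors over an algebraic closure. *)
Lemma det_gram_neq0 : \det (gram F) != 0.
Proof.
apply/negP => /det0P[w w0 wB].
have [u [v [uA _ _]]] := complete_basis w0; set A := row3mx w u v in uA.
have [K [f _]] := countable_algebraic_closure L.
have n2K : 2%:R != 0 :> K by rewrite -(rmorph_nat f) fmorph_eq0.
have [C CE] : {C | C = A *m gram F *m A^T} by exists (A *m gram F *m A^T).
have sC : C^T = C by rewrite CE !trmx_mul trmxK gram_sym mulmxA.
have C0 j : C o0 j = 0 by rewrite CE bf_row3mx /bf wB mul0mx mxE.
have C0' j : C j o0 = 0 by rewrite symE.
pose Q := map_mx f (invmx A).
have uQ : Q \in unitmx by rewrite map_unitmx unitmx_inv.
have BE : map_mx f (gram F) = Q *m map_mx f C *m Q^T.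
  rewrite /Q map_trmx -!map_mxM; congr map_mx; rewrite CE !mulmxA mulVmx // mul1mx.
  by rewrite trmx_inv -mulmxA mulmxV ?unitmx_tr // mulmx1.
(* Such [t1], [t2] give a factorization of the form into two linear forms; a constant linear form is
   0. *)
have FE (t1 t2 : 'cV[K]_3) :
    t1 *m t2^T + t2 *m t1^T = map_mx f C + map_mx f C ->
    t1 = 0 \/ t2 = 0.
  move=> e; have : map_mpoly f F = lpoly (Q *m t1) * lpoly (Q *m t2).
    rewrite {1}(qpoly_gram n2 hF) map_qpoly lpolyM; apply: qpoly_eq => //.
    rewrite map_trmx gram_sym BE !trmx_mul !trmxK -mulmxDl -mulmxDr -e.
    by rewrite !mulmxDr !mulmxDl !mulmxA.
  case/irrF=> /lpoly_const /(congr1 (mulmx (invmx Q))).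
    by rewrite mulKmx // mulmx0; left.
  by rewrite mulKmx // mulmx0; right.
pose c i j := f (C i j).
have c0 j : c o0 j = 0 by rewrite /c C0 rmorph0.
have c0' j : c j o0 = 0 by rewrite /c C0' rmorph0.
have c21 : c o2 o1 = c o1 o2 by rewrite /c symE.
pose col3 (x y z : K) : 'cV[K]_3 := (row3 x y z)^T.
(* Without a square term in the second variable, the third variable is a factor; its cofactor can
   vanish only if the whole form does. *)
have [c11|c11] := eqVneq (c o1 o1) 0.
  have [] := FE (col3 0 0 1) (col3 0 (2%:R * c o1 o2) (c o2 o2)).
  - apply/matrixP => i j; rewrite !mxE !big_ord1 !mxE -/(c i j); move: j i.
    by apply: ord3P; apply: ord3P; rewrite /= ?c0 ?c0' ?c21 ?c11; ring.
  - by move=> /colP/(_ o2)/eqP; rewrite !mxE /= oner_eq0.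
  move=> /colP e; have := e o1; have := e o2; rewrite !mxE /= => c22 /eqP.
  rewrite mulf_eq0 (negPf n2K) /= => /eqP c12.
  case/negP: F0; apply/eqP; rewrite (qpoly_gram n2 hF).
  have -> : gram F = 0.
    apply/matrixP => i j; apply: (fmorph_inj f); rewrite [in RHS]mxE rmorph0.
    have /matrixP/(_ i j) := BE; rewrite mxE => ->.
    have -> : map_mx f C = 0.
      apply/matrixP => i' j'; rewrite !mxE -/(c i' j'); move: j' i'.
      by apply: ord3P; apply: ord3P; rewrite ?c0 ?c0' ?c21.
    by rewrite mulmx0 mul0mx mxE.
  by rewrite /qpoly big1 // => i _; rewrite big1 // => j _; rewrite mxE scale0r.
(* A square root of the discriminant of the binary form yields its two factors. *)
have [d dE] := closed_sqrt (c o1 o2 ^+ 2 - c o1 o1 * c o2 o2).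
have [] := FE (col3 0 (c o1 o1) (c o1 o2 + d)) (col3 0 1 ((c o1 o2 - d) / c o1 o1)).
- have c22 : c o2 o2 = (c o1 o2 ^+ 2 - d ^+ 2) / c o1 o1 by rewrite dE; field.
  apply/matrixP => i j; rewrite !mxE !big_ord1 !mxE -/(c i j); move: j i.
  by apply: ord3P; apply: ord3P; rewrite /= ?c0 ?c0' ?c21 ?c22; field.
- by move=> /colP/(_ o1)/eqP; rewrite !mxE /= (negPf c11).
- by move=> /colP/(_ o1)/eqP; rewrite !mxE /= oner_eq0.
Qed.

End Irreducible.

(** * External points *)

Section External.
Variables (L : finFieldType) (F : {mpoly L[3]}).
Hypothesis oddL : odd #|L|.
Hypothesis hF : F \is 2.-homog.
Let B := gram F.
Hypothesis dB : \det B != 0.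
Let n2 := two_neq0 oddL.

Lemma meval_gram (v : {ffun 'I_3 -> L}) : F.@[v] = qf B (vec v).
Proof. by rewrite {1}(qpoly_gram n2 hF) meval_qpoly. Qed.

Lemma vec_grad (v : {ffun 'I_3 -> L}) : vec (grad F v) = vec v *m (2%:R *: B).
Proof.
apply/rowP => k; rewrite -scalemxAr 2!mxE /grad ffunE {1}(qpoly_gram n2 hF).
by rewrite mderiv_qpoly ?gram_sym.
Qed.

Lemma unit_polar : 2%:R *: B \in unitmx.
Proof. by rewrite unitmxE unitfE detZ mulf_neq0 // expf_neq0. Qed.

Lemma vec_normalized_neq0 (v : {ffun 'I_3 -> L}) : normalized v -> vec v != 0.
Proof.
case/existsP=> i /andP[/eqP vi _]; apply/eqP => /rowP/(_ i)/eqP.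
by rewrite !mxE vi oner_eq0.
Qed.

(** The gradient at a vector v is v (2 B), so [invmx (2%:R *: B)] sends a line to its pole, and a
    line is tangent when its pole lies on the conic. *)
Lemma tangent_lineE (l : {ffun 'I_3 -> L}) :
  tangent_line F l = normalized l && (qf B (vec l *m invmx (2%:R *: B)) == 0).
Proof.
have uD := unit_polar; rewrite /tangent_line.
have [nl|] := boolP (normalized l) => //=; apply/exists_inP/eqP.
  case=> P _ /andP[/andP[cP _] /existsP[c /andP[c0 /eqP lE]]].
  have -> : vec l = c *: vec P *m (2%:R *: B).
    by rewrite -scalemxAl -vec_grad; apply/rowP => k; rewrite lE !mxE ffunE.
  by rewrite mulmxK // qf_scale -meval_gram (eqP cP) mulr0.
have [w wdef] : {w | w = vec l *m invmx (2%:R *: B)} by exists (vec l *m invmx (2%:R *: B)).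
rewrite -wdef => qw.
have lE : vec l = w *m (2%:R *: B) by rewrite wdef mulmxKV.
have w0 : w != 0.
  apply: contraNneq (vec_normalized_neq0 nl) => w0.
  by rewrite lE w0 mul0mx.
have [i [P [wi nP wE]]] := normalize w0.
exists P; first by rewrite inE.
have gP : vec l = w 0 i *: vec (grad F P).
  by rewrite lE {1}wE -scalemxAl vec_grad.
apply/andP; split; last first.
  apply/existsP; exists (w 0 i); rewrite wi; apply/eqP/ffunP => k.
  by rewrite [in RHS]ffunE; have /rowP/(_ k) := gP; rewrite !mxE.
apply/andP; split.
  rewrite /on_conic meval_gram; move/eqP: qw.
  by rewrite {1}wE qf_scale mulf_eq0 expf_eq0 /= (negPf wi).
apply: contraNneq (vec_normalized_neq0 nl) => g0; rewrite gP g0.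
by apply/eqP/rowP => k; rewrite !mxE ffunE mulr0.
Qed.

(** The polarity matches tangents through [x] with zeros of the form on the polar of [x]. Both are
    counted as nonzero vectors, whence the factor [#|L| - 1]. *)
Lemma card_tangents (x : {ffun 'I_3 -> L}) : ~~ on_conic F x ->
  ((#|L| - 1) * n_tangents F x)%N =
  if is_square (- \det B * qf B (vec x)) then (2 * (#|L| - 1))%N else 0%N.
Proof.
rewrite /on_conic meval_gram => qx; have uD := unit_polar.
rewrite -(card_polar_zeros oddL (gram_sym F) dB qx).
pose P (w : 'rV[L]_3) := (qf B (w *m invmx (2%:R *: B)) == 0) &&
  ((w *m (vec x)^T) 0 0 == 0).
have PZ s v : s \in [set: L] -> s != 0 -> P (s *: v) = P v.
  move=> _ s0; rewrite /P -!scalemxAl qf_scale mxE !mulf_eq0.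
  by rewrite (negPf s0).
have := card_normalized (in_setT 0) (fun _ _ _ _ => in_setT _) (fun _ _ => in_setT _) PZ.
rewrite cardsT => e.
have -> : n_tangents F x = #|[set v : {ffun 'I_3 -> L} |
      normalized v & [forall i, v i \in [set: L]] && P (vec v)]|.
  apply: eq_card => l; rewrite !inE tangent_lineE -andbA; congr (_ && _).
  have -> : [forall i, l i \in [set: L]] by apply/forallP => i; rewrite inE.
  rewrite /P; congr (_ && (_ == _)); rewrite mxE; apply: eq_bigr => i _.
  by rewrite !mxE.
rewrite -e -[RHS](card_imset _ (can_inj (mulmxK uD))); apply: eq_card => v.
rewrite inE; have -> : [forall i, v 0 i \in [set: L]] by apply/forallP => i; rewrite inE.
have xE (w : 'rV[L]_3) : (w *m (2%:R *: B) *m (vec x)^T) 0 0 = 2%:R * bf B (vec x) w.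
  by rewrite -scalemxAr -scalemxAl mxE -/(bf B w (vec x)) bf_sym ?gram_sym.
rewrite andTb; apply/idP/imsetP => [/and3P[v0 qv xv]|[w]].
  exists (v *m invmx (2%:R *: B)); last by rewrite mulmxKV.
  rewrite inE qv; apply/andP; split.
    by apply: contraNneq v0 => e0; rewrite -[v](mulmxKV uD) e0 mul0mx.
  by move: xv; rewrite -{1}[v](mulmxKV uD) xE mulf_eq0 (negPf n2).
rewrite inE => /and3P[w0 qw xw] ->; rewrite /P mulmxK // qw xE (eqP xw) mulr0 eqxx !andbT.
by apply: contraNneq w0 => e0; rewrite -[w](mulmxK uD) e0 mul0mx.
Qed.

(** Two tangents pass through [x] when [- \det B * qf B (vec x)] is a square, and none otherwise;
    invariance of [eta] under negation absorbs the sign. *)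
Lemma externalE (x : {ffun 'I_3 -> L}) :
  (forall u : L, eta (- u) = eta u) ->
  external F x = (eta (\det B * qf B (vec x)) == 1).
Proof.
move=> etaN; have L1 : (0 < #|L| - 1)%N by rewrite subn_gt0 finNzRing_gt1.
rewrite /external -etaN -mulNr eta_eq1 mulf_eq0 oppr_eq0 (negPf dB) /=.
rewrite -meval_gram -/(on_conic F x); have [//|cx] /= := boolP (on_conic F x).
rewrite -(eqn_pmul2l L1) card_tangents // -meval_gram; case: is_square.
  by rewrite mulnC eqxx.
by rewrite eq_sym muln_eq0 eqn0Ngt L1.
Qed.

End External.

Lemma nrational_gram (L : finFieldType) (q : nat) (sig : {rmorphism L -> L})
  (F : {mpoly L[3]}) : (forall x, sig x = x ^+ q) ->
  2%:R != 0 :> L -> F \is 2.-homog -> ~ defined_over_Fq q F ->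
  nrational sig (gram F).
Proof.
move=> sigE n2 hF nF s B0 /ratmxP rB0; apply/eqP => e; apply: nF.
exists s, (qpoly B0); split; last by rewrite {1}(qpoly_gram n2 hF) e qpolyZ.
move=> m; rewrite /inFq -sigE -FqE mcoeff_qpoly !sum3.
by rewrite !FqD ?FqM ?Fq_nat.
Qed.

(** * From the character sum to the number of external points *)

Section Count.
Variables (L : finFieldType) (q : nat) (sig : {rmorphism L -> L}).
Hypothesis oddq : odd q.
Hypothesis cardL : #|L| = (q ^ 2)%N.
Hypothesis sigE : forall x, sig x = x ^+ q.
Local Notation Fq := (Fq sig).

(** The character value is unchanged by rational scaling, so every external point accounts for q - 1
    vectors. *)
Lemma card_external (F : {mpoly L[3]}) :
  F \is 2.-homog -> \det (gram F) != 0 ->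
  ((q - 1) * Eq q F)%N =
  #|[set v in ratV sig | eta (\det (gram F) * qf (gram F) v) == 1]|.
Proof.
move=> hF dB; set B := gram F.
pose P (v : 'rV[L]_3) := eta (\det B * qf B v) == 1.
have PZ s v : s \in Fq -> s != 0 -> P (s *: v) = P v.
  move=> fs s0; rewrite /P qf_scale.
  have -> : \det B * (s ^+ 2 * qf B v) = s ^+ 2 * (\det B * qf B v) by ring.
  by rewrite (etaM (odd_cardL oddq cardL)) eta_sq // mul1r.
have := card_normalized (Fq0 sig) (@FqM _ sig) (@FqV _ sig) PZ.
rewrite (card_Fq oddq cardL sigE) => e.
have -> : Eq q F = #|[set v : {ffun 'I_3 -> L} |
      normalized v & [forall i, v i \in Fq] && P (vec v)]|.
  apply: eq_card => v; rewrite !inE -andbA; congr [&& _, _ & _].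
    by apply: eq_forallb => i; rewrite FqE sigE.
  by apply: externalE => //; [exact: odd_cardL cardL|exact: etaN sigE].
rewrite -e; apply: eq_card => v; rewrite !inE.
have -> : [forall i, v 0 i \in Fq] = ratmx sig v.
  apply/forallP/ratmxP => [H i j|H i]; last exact: H.
  by rewrite (ord1 i) H.
rewrite /P; have [->|v0] //= := eqVneq v 0.
by rewrite /qf !mul0mx mxE mulr0 eta0 andbF.
Qed.

Lemma good_form_count (F : {mpoly L[3]}) :
  F \is 2.-homog -> \det (gram F) != 0 -> good_form q sig (gram F) ->
  exists n0 a, (n0, a) \in admissible /\
    (2 * Eq q F + n0 = q ^ 2 + (a - 1) * q)%N.
Proof.
move=> hF dB [n0 [a [adm S Z]]]; exists n0, a; split=> //.
have q1 := q_gt1 oddq cardL.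
have := card_external hF dB; set E := Eq q F; set N := #|_| => eN.
(* Pointwise, twice the indicator of [eta = 1] is 1 minus the indicator of a zero plus [eta]; this
   is summed over the q^3 rational vectors. *)
have : N%:Z * 2%:Z = (q ^ 3)%N%:Z - (n0.+1%:Z * (q%:Z - 1) + 1) + q%:Z * (q%:Z - 1) * (a%:Z - 2%:Z).
  rewrite -S -Z /N.
  have -> : (q ^ 3)%N%:Z = \sum_(v in ratV sig) 1.
    rewrite sum_ratV; under eq_bigr => p _ do
      rewrite sumr_const (card_Fq oddq cardL sigE) natz.
    by rewrite sumr_const (card_Fq2 oddq cardL sigE) -mulr_natr natz -PoszM -expnS.
  rewrite -sumrB -big_split /=.
  have -> : (#|[set v in ratV sig | eta (\det (gram F) * qf (gram F) v) == 1]|)%:Z =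
     \sum_(v in ratV sig) (eta (\det (gram F) * qf (gram F) v) == 1)%:R.
    rewrite -sum1_card -natz natr_sum [LHS]big_mkcond [RHS]big_mkcond.
    by apply: eq_bigr => v _; rewrite inE; case: (v \in ratV sig); case: (_ == 1).
  rewrite mulr_suml; apply: eq_bigr => v _.
  rewrite /eta mulf_eq0 (negPf dB) /=; case: (qf _ v == 0) => //.
  by case: is_square.
rewrite -eN => e.
have qn0 : q%:Z - 1 != 0 by lia.
suff eZ : 2%:Z * E%:Z + n0%:Z = q%:Z * q%:Z + (a%:Z - 1) * q%:Z.
  (* Positivity of [a] makes the truncated subtraction [a - 1] a true one. *)
  have a0 : (0 < a)%N by move: adm; case: (a) => //; rewrite !inE !xpair_eqE !andbF.
  have aZ : (a - 1)%N%:Z = a%:Z - 1 by rewrite subzn.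
  apply/eqP; rewrite -eqz_nat -mulnn !(PoszD, PoszM) aZ; exact/eqP.
apply: (mulfI qn0); move: e.
have -> : (q ^ 3)%N%:Z = q%:Z * q%:Z * q%:Z by lia.
have -> : n0.+1%:Z = n0%:Z + 1 by lia.
have -> : ((q - 1) * E)%N%:Z = (q%:Z - 1) * E%:Z by rewrite PoszM; lia.
move=> e; have -> : (q%:Z - 1) * (2%:Z * E%:Z + n0%:Z) =
  (q%:Z - 1) * E%:Z * 2%:Z + (q%:Z - 1) * n0%:Z by ring.
by rewrite e; ring.
Qed.

End Count.

Theorem theorem1p2 (L : finFieldType) (q : nat) (F : {mpoly L[3]}) :
  (exists p k, prime p /\ (0 < k)%N /\ q = (p ^ k)%N) ->
  odd q ->
  #|L| = (q ^ 2)%N ->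
  quadratic_form F ->
  abs_irreducible F ->
  ~ defined_over_Fq q F ->
  (exists x, (x \in pg2q L q) && on_conic F x) ->
  [/\ q = 3%N -> Eq q F \in [:: 3; 4; 5; 6; 7; 8; 9]%N,
      q = 5%N -> Eq q F \in [:: 11; 12; 14; 15; 16; 17; 19; 20; 21; 22; 25]%N
    & (5 < q)%N ->
      exists n0 alpha : nat,
        [/\ n0 \in [:: 0; 1; 2; 3]%N, alpha \in [:: 1; 2; 3; 4; 5; 7]%N,
            ~~ odd (alpha + n0)
          & (2 * Eq q F + n0 = q ^ 2 + (alpha - 1) * q)%N]].
Proof.
move=> [p [k [pp [k0 qE]]]] oddq cardL [F0 hF] irrF ndF [x /andP[xq cx]].
have oddL := odd_cardL oddq cardL; have n2 := two_neq0 oddL.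
(* L has degree [k * 2] over its prime field, and the [k]-th Frobenius iterate is the [q]-th power
   map. *)
have [|sig sigE'] := @finField_Frobenius_iter L p k (k * 2) pp.
  by rewrite cardL qE expnM.
have sigE y : sig y = y ^+ q by rewrite sigE' qE.
have dB := det_gram_neq0 n2 hF F0 irrF.
have gF : good_form q sig (gram F).
  move: xq; rewrite inE => /andP[nx /forallP rx].
  apply: (@good_form_of_rational_zero _ _ _ oddq cardL sigE _ (vec x)) => //.
  - exact: gram_sym.
  - exact: nrational_gram sigE n2 hF ndF.
  - by apply/ratmxP => i j; rewrite mxE FqE sigE; apply: rx.
  - exact: vec_normalized_neq0.
  - by rewrite -(meval_gram oddL hF); apply/eqP.
have [n [a [adm Ena]]] := good_form_count oddq cardL sigE hF dB gF.
have EE : Eq q F = ((q ^ 2 + (a - 1) * q) - n)./2 by rewrite -Ena addnK mul2n doubleK.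
move: adm; rewrite /admissible => adm; split=> [q3|q5|_].
(* The eight pairs give 6, 9, 4, 7, 5, 8, 3 and 9. *)
- by move: adm; rewrite !inE EE q3;
    do 7?[case/orP=> [/eqP[-> ->] //|]]; move=> /eqP[-> ->].
(* The eight pairs give 15, 20, 12, 17, 14, 19, 11 and 21. *)
- by move: adm; rewrite !inE EE q5;
    do 7?[case/orP=> [/eqP[-> ->] //|]]; move=> /eqP[-> ->].
exists n, a; split=> //; move: adm; rewrite !inE;
  do 7?[case/orP=> [/eqP[nE aE]|]; first by rewrite ?nE ?aE];
  by move=> /eqP[nE aE]; rewrite ?nE ?aE.
Qed.
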